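(* Let $d\ge 1$, $M\in\mathbb{N}$ with $M\ge 2$, $p\in(M^{-d},1]$, let $F$ be a fractal percolation on $[0,1]^d$ with parameters $M$ and $p$ and construction steps $F_n$, let $Z^{d-1}_n:=M^{(d-1-D)n}V_{d-1}(F_n)$, and let $Z^{d-1}_\infty$ denote the almost sure limit of $Z^{d-1}_n$ as $n\to\infty$. Then, for any $n\in\mathbb{N}$, $$\mathbb{E}Z^{d-1}_n-\mathbb{E}Z^{d-1}_\infty=\frac{dp(M-1)}{M-p}\left(\frac pM\right)^n,$$ and, as $n\to\infty$, $$\mathrm{Var}(Z^{d-1}_\infty)-\mathrm{Var}(Z^{d-1}_n)=\begin{cases}O\big((p/M)^n\big), & \text{if } p^2>1/M^{d-1},\\ O\big((p/M)^n\cdot n\big), & \text{if } p^2=1/M^{d-1},\\ O\big((M^dp)^{-n}\big), & \text{if } p^2<1/M^{d-1}.\end{cases}$$ In particular, $\mathrm{Var}(Z^{d-1}_n)\to\mathrm{Var}(Z^{d-1}_\infty)$ as $n\to\infty$.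
   Context: Fractal percolation: Let $J=[0,1]^d$, $\Sigma=\{1,\ldots,M^d\}$, let $J_1,\ldots,J_{M^d}$ be the $M^d$ closed subcubes of side length $1/M$ into which $J$ is divided, and let $\varphi_j$ be the homothetic (rotation- and reflection-free) similarity mapping $J$ onto $J_j$. For $\sigma=\sigma_1\ldots\sigma_n\in\Sigma^n$ let $J_\sigma=\varphi_{\sigma_1}\circ\cdots\circ\varphi_{\sigma_n}(J)$, and for $m\le n$ let $\sigma|m=\sigma_1\ldots\sigma_m$. Let $\{Y_\sigma:\sigma\in\bigcup_{n\ge1}\Sigma^n\}$ be i.i.d. Bernoulli variables with parameter $p$. Put $F_0=J$ and, for $n\ge1$, let $F_n$ be the union of all $J_\sigma$, $\sigma\in\Sigma^n$, with $Y_{\sigma|1}=\cdots=Y_{\sigma|n}=1$. The fractal percolation is $F=\bigcap_n F_n$. $D:=\log(M^dp)/\log M$, so $M^{d-1-D}=(Mp)^{-1}$. $V_{d-1}$ is the intrinsic volume of order $d-1$ (half the surface area), extended additively to finite unions of compact convex sets, with $V_{d-1}(\emptyset)=0$. For $p>M^{-d}$ the almost sure limit $Z^{d-1}_\infty$ is known to exist. The constants in the $O$-terms may depend on $d,M,p$. *)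

(* Defs.v *)
From HB Require Import structures.
From mathcomp Require Import all_boot all_order all_algebra.
From mathcomp Require Import all_classical all_reals all_analysis.
Import Order.TTheory GRing.Theory Num.Theory.
Import numFieldNormedType.Exports.

Set Implicit Arguments.
Unset Strict Implicit.
Unset Printing Implicit Defensive.

Local Open Scope classical_set_scope.
Local Open Scope ring_scope.

(* Lebesgue measure on R^n, as the n-fold product of the Lebesgue measure on R:
   the successor case is the library's product measure (m1 \x m2), i.e. the
   m1-integral of the m2-measure of the sections, with R^(n.+1) read as R * R^n.
   It is only meaningful on Borel sets. *)
Fixpoint vol (R : realType) (n : nat) : set 'rV[R]_n -> \bar R :=
  match n with
  | 0 => fun A => (\1_A (0 : 'rV[R]_0))%:E
  | m.+1 => fun A =>
      (\int[@lebesgue_measure R]_x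
          vol [set v : 'rV[R]_m | A (row_mx (const_mx x : 'rV[R]_1) v)])%E
  end.

(* The norm that MathComp-Analysis puts on 'rV[R]_n is the sup norm. *)
Definition enorm (R : realType) (n : nat) (x : 'rV[R]_n) : R :=
  Num.sqrt (\sum_(i < n) x ord0 i ^+ 2).

Definition ball_vol (R : realType) (n : nat) : R :=
  fine (vol [set x : 'rV[R]_n | enorm x <= 1]).

Definition parallel_set (R : realType) (d : nat) (K : set 'rV[R]_d) (e : R) :
    set 'rV[R]_d :=
  [set x | exists2 y, K y & enorm (x - y) <= e].

Definition convex_body (R : realType) (d : nat) (K : set 'rV[R]_d) : Prop :=
  compact K /\ convex_set K.

Definition polyconvex (R : realType) (d : nat) (A : set 'rV[R]_d) : Prop :=
  exists m (K : 'I_m -> set 'rV[R]_d),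
    (forall i, convex_body (K i)) /\ A = \bigcup_i K i.

(* V 0, ..., V d are the intrinsic volumes on R^d: on compact convex sets they
   are the normalized coefficients of the Steiner formula, which determines
   them there, and they are extended additively to the finite unions of such
   sets.  Nothing is said of V k A for d < k or for A not polyconvex. *)
Record intrinsic_volumes (R : realType) (d : nat)
    (V : nat -> set 'rV[R]_d -> R) : Prop := IntrinsicVolumes {
  steiner_formula : forall (K : set 'rV[R]_d) (e : R),
    convex_body K -> 0 <= e ->
    vol (parallel_set K e) =
      (\sum_(k < d.+1) ball_vol R (d - k) * V k K * e ^+ (d - k))%:E;
  intrinsic_volume_set0 : forall k, (k <= d)%N -> V k set0 = 0;
  intrinsic_volumeUI : forall k (A B : set 'rV[R]_d), (k <= d)%N ->
    polyconvex A -> polyconvex B ->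
    V k (A `|` B) + V k (A `&` B) = V k A + V k B }.

Definition unit_cube (R : realType) (d : nat) : set 'rV[R]_d :=
  [set x | forall i, 0 <= x ord0 i <= 1].

(* The M^d subcubes are numbered by 0, ..., M^d - 1, the i-th coordinate of the
   position of the j-th one being the i-th digit of j in base M. *)
Definition phi (R : realType) (d M : nat) (j : 'I_(M ^ d)) (x : 'rV[R]_d) :
    'rV[R]_d :=
  \row_(i < d) ((x ord0 i + (j %/ M ^ i %% M)%:R) / M%:R).

Definition cube (R : realType) (d M : nat) (s : seq 'I_(M ^ d)) :
    set 'rV[R]_d :=
  foldr (fun j f => @phi R d M j \o f) id s @` @unit_cube R d.

Definition mutually_independent (I : eqType) (D : set I) (R : realType)
    (dO : measure_display) (Omega : measurableType dO) (P : probability Omega R)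
    (dT : measure_display) (T : measurableType dT) (X : I -> {RV P >-> T}) :
    Prop :=
  forall (s : seq I) (B : I -> set T),
    uniq s -> (forall i, i \in s -> D i) ->
    (forall i, i \in s -> measurable (B i)) ->
    P (\bigcap_(i in [set` s]) (X i @^-1` B i)) =
      (\prod_(i <- s) P (X i @^-1` B i))%E.

(* Y is indexed by all words; its value at the empty word plays no role. *)
Definition iid_bernoulli (R : realType) (d M : nat) (p : R)
    (dO : measure_display) (Omega : measurableType dO) (P : probability Omega R)
    (Y : seq 'I_(M ^ d) -> {RV P >-> bool}) : Prop :=
  (forall s B, s <> [::] -> distribution P (Y s) B = bernoulli_prob p B) /\
  mutually_independent [set s | s <> [::]] Y.

Definition perc_step (R : realType) (d M : nat) (T : Type)
    (Y : seq 'I_(M ^ d) -> T -> bool) (n : nat) (w : T) : set 'rV[R]_d :=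
  \bigcup_(s in [set s : n.-tuple 'I_(M ^ d) |
                  forall m, (1 <= m <= n)%N -> Y (take m s) w])
    @cube R d M s.

Definition perc_dim (R : realType) (d M : nat) (p : R) : R :=
  ln (M%:R ^+ d * p) / ln M%:R.

(* Z^{d-1}_n *)
Definition Zsurf (R : realType) (d M : nat) (p : R)
    (V : nat -> set 'rV[R]_d -> R) (T : Type)
    (Y : seq 'I_(M ^ d) -> T -> bool) (n : nat) (w : T) : R :=
  M%:R `^ ((d%:R - 1 - perc_dim d M p) * n%:R) * V d.-1 (perc_step Y n w).

(* Main.v *)
(** Rescaled by [M ^ n], the intrinsic volume of order [d - 1] of [F_n] is
    [d N_n - A_n], where [N_n] counts the kept cubes and [A_n] the pairs of kept
    cubes sharing a facet.  Conditionally on level [n], the pair [(N, A)] evolves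
    linearly: with [a = p / M] and [b = 1 / (M ^ d p)], the normalized
    count [b ^ n N_n] is a martingale, and [b ^ n (kappa N_n - A_n)] is an
    eigenvector for the eigenvalue [a], where [kappa = d p (M - 1) / (M - p)].
    This gives the mean.  For second moments the same recursion
    holds up to the contribution of the pairs of patterns with a common cube,
    which is [O (b ^ n)] after normalization; so second moments change at step [n]
    by [O (rate n)], with [rate n = sum_(k <= n) a ^ (n - k) b ^ k].  Hence [Z_n] is
    Cauchy in [L^2], and Fatou's lemma identifies its limit with [Z_oo]. *)

Require Import Defs.
From HB Require Import structures.
From mathcomp Require Import all_boot all_order all_algebra.
From mathcomp Require Import all_classical all_reals all_analysis.
From mathcomp Require Import measurable_realfun ring lra zify.
Import Order.TTheory GRing.Theory Num.Theory.
Import numFieldNormedType.Exports.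

Set Implicit Arguments.
Unset Strict Implicit.
Unset Printing Implicit Defensive.

Local Open Scope classical_set_scope.
Local Open Scope ring_scope.

(** * The Steiner formula for boxes *)

(** [V] is known only through the Steiner formula on convex bodies and additivity, so [V_{d-1}] has
    to be extracted: for a box the Steiner polynomial is squeezed between two polynomials, and
    unions of cubes are reached by comparison with a counting valuation, which replaces
    inclusion-exclusion. Faces of dimension below [d - 1] contribute nothing, hence only pairs
    sharing a facet survive. As a cube of side [M^-n] has [V_{d-1} = d M^(-n(d-1))], the
    normalization turns into [Z_n = b^n (d N_n - A_n)]. Independence enters only through the
    probability that finitely many words are all kept, which is [p] to the number of their distinct
    nonempty prefixes. Every moment is then a finite sum of such powers, and no conditional
    expectation is formed. The three regimes come from [rate]: errors of order [b^k] enter at every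
    level [k] and are damped by [a] at each later level, and [a = b] exactly when
    [p^2 = M^(1-d)]. *)

Lemma le_integral_ge0 (dT : measure_display) (T : measurableType dT)
    (R : realType) (mu : {measure set T -> \bar R}) (f g : T -> \bar R) :
  (forall x, 0 <= f x)%E -> (forall x, f x <= g x)%E ->
  (\int[mu]_x f x <= \int[mu]_x g x)%E.
Proof.
move=> f0 fg; have g0 x : (0 <= g x)%E := le_trans (f0 x) (fg x).
(* The integral of a nonnegative function is a supremum over the simple functions below it, so
   monotonicity needs no measurability; the section volumes of a parallel set are never shown
   measurable. *)
rewrite !ge0_integralE// !patch_setT; apply: ereal_sup_le => _ [h hf <-].
by exists h => //= x; exact: le_trans (hf x) (fg x).
Qed.

Section volume.
Context {R : realType}.
Local Notation mu := (@lebesgue_measure R).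

Definition box (d : nat) (lo hi : 'I_d -> R) : set 'rV[R]_d :=
  [set x | forall i, lo i <= x ord0 i <= hi i].

Lemma vol_ge0 d (A : set 'rV[R]_d) : (0 <= vol A)%E.
Proof.
elim: d A => [|d IH] A /=; first by rewrite lee_fin.
by apply: integral_ge0.
Qed.

Lemma vol_set0 d : vol (set0 : set 'rV[R]_d) = 0%E.
Proof.
elim: d => [|d IH] /=; first by rewrite indicE in_set0.
by rewrite integral0_eq.
Qed.

Lemma le_vol d (A B : set 'rV[R]_d) : A `<=` B -> (vol A <= vol B)%E.
Proof.
elim: d A B => [|d IH] A B AB /=.
  rewrite lee_fin !indicE ler_nat; case: (boolP (_ \in A)) => // /set_mem A0.
  by rewrite mem_set//; exact: AB.
apply: le_integral_ge0 => x; first exact: vol_ge0.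
by apply: IH => v /=; exact: AB.
Qed.

Lemma row_mx_const0 d (x : R) (v : 'rV[R]_d) :
  (row_mx (const_mx x : 'rV_1) v : 'rV_(d.+1)) ord0 ord0 = x.
Proof.
transitivity ((const_mx x : 'rV[R]_1) ord0 ord0); last by rewrite mxE.
have -> : (ord0 : 'I_d.+1) = lshift d (ord0 : 'I_1) by exact: val_inj.
exact: row_mxEl.
Qed.

Lemma row_mx_const_lift d (x : R) (v : 'rV[R]_d) (i : 'I_d) :
  (row_mx (const_mx x : 'rV_1) v : 'rV_(d.+1)) ord0 (lift ord0 i) = v ord0 i.
Proof. by rewrite -[RHS](row_mxEr (const_mx x : 'rV_1)) rshift1. Qed.

Lemma row_mx_constB d (x y : R) (v w : 'rV[R]_d) :
  (row_mx (const_mx x : 'rV_1) v : 'rV_(d.+1)) - row_mx (const_mx y : 'rV_1) w =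
  row_mx (const_mx (x - y) : 'rV_1) (v - w).
Proof.
apply/rowP => i; rewrite [LHS]mxE [X in _ + X]mxE.
case: (unliftP ord0 i) => [j ->|->]; last by rewrite !row_mx_const0.
by rewrite !row_mx_const_lift !mxE.
Qed.

Lemma box_row_mx d (lo hi : 'I_d.+1 -> R) (x : R) (v : 'rV[R]_d) :
  box lo hi (row_mx (const_mx x : 'rV_1) v) <->
  lo ord0 <= x <= hi ord0 /\
    box (lo \o lift ord0) (hi \o lift ord0) v.
Proof.
split=> [B|[Bx Bv] i].
  split; first by have := B ord0; rewrite row_mx_const0.
  by move=> i; have := B (lift ord0 i); rewrite row_mx_const_lift.
case: (unliftP ord0 i) => [j ->|->]; last by rewrite row_mx_const0.
by rewrite row_mx_const_lift; exact: Bv.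
Qed.

Lemma integral_indic_itv (c a b : R) (ba bb : bool) : 0 <= c -> a <= b ->
  (\int[mu]_x (c * \1_[set` Interval (BSide ba a) (BSide bb b)] x)%:E =
   (c * (b - a))%:E)%E.
Proof.
move=> c0 ab; under eq_integral do rewrite EFinM.
rewrite ge0_integralZl_EFin//; last first.
  by apply/measurable_EFinP; exact: measurable_indic.
rewrite integral_indic//= setIT lebesgue_measure_itv/= lte_fin.
by case: ltgtP ab => // ->; rewrite subrr mule0 mulr0.
Qed.

Lemma vol_box d (lo hi : 'I_d -> R) : (forall i, lo i <= hi i) ->
  vol (box lo hi) = (\prod_i (hi i - lo i))%:E.
Proof.
elim: d lo hi => [|d IH] lo hi lohi /=.
  by rewrite big_ord0 indicE mem_set// => -[].
rewrite big_ord_recl mulrC -(integral_indic_itv true false)//; last first.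
  by apply: prodr_ge0 => i _; rewrite subr_ge0.
apply: eq_integral => x _; rewrite indicE.
have [xin|xnin] := boolP (x \in `[lo ord0, hi ord0]).
  rewrite mem_set// mulr1 -[RHS](IH (lo \o lift ord0) (hi \o lift ord0));
    last by move=> i; exact: lohi.
  congr vol; apply/seteqP; split=> v /=.
    by move/box_row_mx => [].
  by move=> Bv; apply/box_row_mx.
rewrite memNset; last by move=> /=; exact/negP.
rewrite mulr0 (_ : [set v | _] = set0) ?vol_set0// -subset0 => v /box_row_mx[].
by move=> xin; move: xnin; rewrite in_itv/= xin.
Qed.

Lemma normr_coord_le_enorm d (x : 'rV[R]_d) i : `|x ord0 i| <= enorm x.
Proof.
rewrite -sqrtr_sqr /enorm ler_wsqrtr// (bigD1 i)//= lerDl.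
by apply: sumr_ge0 => j _; exact: sqr_ge0.
Qed.

Lemma enorm_row_mx0 d (v : 'rV[R]_d) :
  enorm (row_mx (const_mx 0 : 'rV_1) v : 'rV_(d.+1)) = enorm v.
Proof.
rewrite /enorm big_ord_recl row_mx_const0.
rewrite expr0n add0r; congr Num.sqrt; apply: eq_bigr => i _.
by rewrite row_mx_const_lift.
Qed.

Lemma enorm_row_mx d (x : R) :
  enorm (row_mx (const_mx x : 'rV_1) (0 : 'rV_d) : 'rV_(d.+1)) = `|x|.
Proof.
rewrite /enorm big_ord_recl row_mx_const0 big1 ?addr0 ?sqrtr_sqr// => i _.
by rewrite row_mx_const_lift mxE expr0n.
Qed.

Lemma parallel_box_sub d (lo hi : 'I_d -> R) (e : R) :
  parallel_set (box lo hi) e `<=` box (fun i => lo i - e) (fun i => hi i + e).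
Proof.
move=> x [y By xye] i; have /andP[loy yhi] := By i.
have := le_trans (normr_coord_le_enorm (x - y) i) xye.
rewrite !mxE ler_norml => /andP[h1 h2].
by apply/andP; split; lra.
Qed.

Lemma vol_parallel_box_le d (lo hi : 'I_d -> R) (e : R) :
  (forall i, lo i <= hi i) -> 0 <= e ->
  (vol (parallel_set (box lo hi) e) <= (\prod_i (hi i - lo i + e *+ 2))%:E)%E.
Proof.
move=> lohi e0; apply: le_trans (le_vol (@parallel_box_sub _ _ _ _)) _.
rewrite vol_box => [|i].
  by rewrite lee_fin le_eqVlt; apply/orP; left; apply/eqP/eq_bigr => i _;
     ring.
by have := lohi i; lra.
Qed.

End volume.

(** * Intrinsic volumes of order [d - 1] of boxes *)

Section intrinsic_volume_of_boxes.
Context {R : realType}.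

Definition face_sum (d : nat) (a : 'I_d -> R) : R :=
  \sum_(i < d) \prod_(j < d | j != i) a j.

Lemma face_sum_recl d (a : 'I_d.+1 -> R) :
  face_sum a = \prod_(i < d) a (lift ord0 i) +
               a ord0 * face_sum (a \o lift ord0).
Proof.
rewrite /face_sum big_ord_recl; congr +%R.
  by rewrite big_mkcond big_ord_recl eqxx /= mul1r.
rewrite mulr_sumr; apply: eq_bigr => i _.
rewrite big_mkcond big_ord_recl /=; congr *%R.
by rewrite [RHS]big_mkcond; apply: eq_bigr => j _; rewrite (inj_eq lift_inj).
Qed.

Lemma face_sum_ge0 d (a : 'I_d -> R) : (forall i, 0 <= a i) -> 0 <= face_sum a.
Proof. by move=> a0; apply: sumr_ge0 => i _; apply: prodr_ge0. Qed.

(** The parallel set contains the box and, over each of its [2 d] facets, a slab of thickness [e].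
    Slicing along the first coordinate gives the induction: over the edge the slices contain the
    lower-dimensional parallel set, and within [e] of its ends they contain the lower-dimensional
    box. *)
Lemma vol_parallel_box_ge d (lo hi : 'I_d -> R) (e : R) :
  (forall i, lo i <= hi i) -> 0 <= e ->
  ((\prod_i (hi i - lo i) + e *+ 2 * face_sum (fun i => hi i - lo i))%:E <=
    vol (parallel_set (box lo hi) e))%E.
Proof.
move=> + e0; elim: d lo hi => [|d IH] lo hi lohi /=.
  rewrite /face_sum !big_ord0 mulr0 addr0 indicE mem_set//.
  by exists 0 => [[]//|]; rewrite subrr /enorm big_ord0 sqrtr0.
pose lo' := lo \o lift ord0; pose hi' := hi \o lift ord0.
have lohi' i : lo' i <= hi' i by exact: lohi.
have a0 i : 0 <= hi i - lo i by rewrite subr_ge0.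
pose v' := \prod_i (hi' i - lo' i).
pose l' := v' + e *+ 2 * face_sum (fun i => hi' i - lo' i).
have v'0 : 0 <= v' by apply: prodr_ge0 => i _; rewrite subr_ge0.
have l'0 : 0 <= l'.
  by rewrite addr_ge0// mulr_ge0// ?mulrn_wge0// face_sum_ge0// => i; rewrite subr_ge0.
(* Minorants of the slice volume on the edge and on either side of it. The outer intervals are open
   at the edge, so the three supports are disjoint. *)
pose f1 (x : R) := (l' * \1_(`[lo ord0, hi ord0]%classic) x)%:E.
pose f2 (x : R) := (v' * \1_(`[lo ord0 - e, lo ord0[%classic) x)%:E.
pose f3 (x : R) := (v' * \1_(`]hi ord0, hi ord0 + e]%classic) x)%:E.
have mf (c : R) (i : interval R) : measurable_fun setT
    (fun x : R => (c * \1_[set` i] x)%:E).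
  apply/measurable_EFinP/measurable_funM => //.
have f1_ge0 x : (0 <= f1 x)%E by rewrite lee_fin mulr_ge0.
have f2_ge0 x : (0 <= f2 x)%E by rewrite lee_fin mulr_ge0.
have f3_ge0 x : (0 <= f3 x)%E by rewrite lee_fin mulr_ge0.
rewrite (_ : (_ + _)%:E = \int[lebesgue_measure]_x (f1 x + (f2 x + f3 x)))%E.
  apply: le_integral_ge0 => x; first by rewrite !adde_ge0.
  have near_face c : lo ord0 <= c <= hi ord0 -> `|x - c| <= e ->
      (v'%:E <= vol [set v | parallel_set (box lo hi) e
                 (row_mx (const_mx x : 'rV_1) v : 'rV_(d.+1))])%E.
    move=> cin xce; rewrite -(@vol_box _ _ lo' hi')//.
    apply: le_vol => v Bv /=; exists (row_mx (const_mx c : 'rV_1) v).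
      exact/box_row_mx.
    by rewrite row_mx_constB subrr enorm_row_mx.
  have inside : lo ord0 <= x <= hi ord0 ->
      (l'%:E <= vol [set v | parallel_set (box lo hi) e
                 (row_mx (const_mx x : 'rV_1) v : 'rV_(d.+1))])%E.
    move=> xin; apply: le_trans (IH _ _ lohi') (le_vol _) => v [y By vy] /=.
    exists (row_mx (const_mx x : 'rV_1) y); first exact/box_row_mx.
    by rewrite row_mx_constB subrr enorm_row_mx0.
  have indE (i : interval R) : \1_[set` i] x = (x \in i)%:R :> R.
    by rewrite indicE; congr (nat_of_bool _)%:R; apply/idP/idP; rewrite inE.
  rewrite /f1 /f2 /f3 !indE !in_itv/=.
  have [xlo|xlo] := ltP x (lo ord0).
    have lohi0 := lohi ord0.
    rewrite (ltNge (hi _)) (le_trans (ltW xlo) lohi0)/= andbT !mulr0 add0e adde0.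
    case: (leP (lo ord0 - e) x) => [lox|_] /=; last by rewrite mulr0 vol_ge0.
    rewrite mulr1; by apply: (near_face (lo ord0)); rewrite ?lexx// ler_norml; lra.
  have -> : (x <= hi ord0) = ~~ (hi ord0 < x) by rewrite leNgt.
  rewrite andbF mulr0 add0e.
  have [xhi|xhi] := ltP (hi ord0) x; last first.
    by rewrite /= mulr1 mulr0 adde0 inside// xlo.
  rewrite mulr0 add0e /=; case: (leP x (hi ord0 + e)) => [hix|_] /=; last by rewrite mulr0 vol_ge0.
  rewrite mulr1;   apply: (near_face (hi ord0)); rewrite ?lexx ?lohi// ler_norml; lra.
rewrite ge0_integralD//; [|exact: mf|by move=> x _; rewrite adde_ge0|].
  rewrite ge0_integralD//; [|exact: mf|exact: mf].
  rewrite /f1 /f2 /f3 !integral_indic_itv ?lerDl ?lerBlDr ?lerDl ?lohi//.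
  rewrite -!EFinD big_ord_recl face_sum_recl.
  congr EFin; rewrite /l' /v' /lo' /hi' /comp; ring.
by apply: emeasurable_funD; [exact: mf|exact: mf].
Qed.

(** [Q - P] vanishes at 0, hence is ['X] times a polynomial that is nonnegative on the positive
    reals; the value of that polynomial at 0 is the difference of the coefficients, and it is
    nonnegative by continuity. *)
Lemma ler_coef1 (P Q : {poly R}) : (forall x, 0 <= x -> P.[x] <= Q.[x]) ->
  P`_0 = Q`_0 -> P`_1 <= Q`_1.
Proof.
move=> PQ PQ0; pose D := Q - P; rewrite -subr_ge0 -coefB -/D.
have D0 : take_poly 1 D = 0.
  by apply/polyP => -[|i]; rewrite coef_take_poly coef0//= coefB PQ0 subrr.
have DE : D = drop_poly 1 D * 'X by rewrite -[LHS](poly_take_drop 1) D0 add0r.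
have -> : D`_1 = (drop_poly 1 D).[0] by rewrite horner_coef0 coef_drop_poly.
have /cvg_at_right_filter cD : (drop_poly 1 D).[x] @[x --> 0] --> (drop_poly 1 D).[0].
  exact: continuous_horner.
apply: (cvgr_to_ge cD).
near=> x; have x0 : 0 < x by [].
have := PQ x (ltW x0); rewrite -subr_ge0 -hornerN -hornerD -/D {1}DE hornerM hornerX.
by rewrite pmulr_lge0.
Unshelve. all: by end_near. Qed.

Lemma coef1_prod_linear d (a : 'I_d -> R) :
  (\prod_i ((a i)%:P + 2%:R *: 'X))`_1 = 2%:R * face_sum a /\
  (\prod_i ((a i)%:P + 2%:R *: 'X))`_0 = \prod_i a i.
Proof.
elim: d a => [|d IH] a; first by rewrite /face_sum !big_ord0 mulr0 !coefC.
have [/= IH1 IH0] := IH (a \o lift ord0).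
rewrite !big_ord_recl face_sum_recl mulrDl -scalerAl !coefD !coefCM !coefZ !coefXM/=.
by rewrite IH1 IH0; split; ring.
Qed.

Lemma ball_vol1 : ball_vol R 1 = 2.
Proof.
rewrite /ball_vol (_ : [set x | _] = box (fun=> -1) (fun=> 1)).
  by rewrite vol_box ?big_ord1/= => [|i]; rewrite ?opprK// lerN10.
have enormE (x : 'rV[R]_1) : enorm x = `|x ord0 ord0|.
  by rewrite /enorm big_ord1 sqrtr_sqr.
apply/seteqP; split => x; rewrite /box /= enormE ler_norml; last exact.
by move=> x1 i; rewrite (ord1 i).
Qed.

Lemma compact_box d (lo hi : 'I_d -> R) : compact (box lo hi).
Proof.
have -> : box lo hi = [set v | forall i, `[lo i, hi i]%classic (v ord0 i)].
  by apply/seteqP; split => v /= h i; have := h i; rewrite in_itv.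
apply: (@rV_compact _ _ (fun i => `[lo i, hi i]%classic)) => i.
exact: segment_compact.
Qed.

Lemma convex_body_box d (lo hi : 'I_d -> R) : convex_body (box lo hi).
Proof.
split; first exact: compact_box.
apply/convex_setW => x y; rewrite !inE => Bx By l l0 l1.
rewrite inE => i.
rewrite -[conv l x y]/(l%:num *: (x : 'rV[R]_d) + (1 - l%:num) *: (y : 'rV[R]_d)).
rewrite !mxE; have /andP[x1 x2] := Bx i; have /andP[y1 y2] := By i.
by apply/andP; split; nra.
Qed.

(* The Steiner polynomial lies between two polynomials that agree up to order 1. *)
Lemma intrinsic_volume_box d V (lo hi : 'I_d -> R) :
  intrinsic_volumes V -> (0 < d)%N -> (forall i, lo i <= hi i) ->
  V d.-1 (box lo hi) = face_sum (fun i => hi i - lo i).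
Proof.
move=> hV; case: d V lo hi hV => // d V lo hi hV _ lohi /=.
pose a i := hi i - lo i.
pose S : {poly R} :=
  \sum_(k < d.+2) (ball_vol R (d.+1 - k) * V k (box lo hi)) *: 'X^(d.+1 - k).
have hS (x : R) : 0 <= x -> vol (parallel_set (box lo hi) x) = S.[x]%:E.
  move=> x0; rewrite (steiner_formula hV (convex_body_box _ _) x0).
  rewrite horner_sum; congr EFin; apply: eq_bigr => k _.
  by rewrite !hornerE.
(* The dimension is [d.+1] here, so degree 1 comes from the summand [k = d] alone, with the factor
   [ball_vol R 1 = 2]. *)
have S1 : S`_1 = 2 * V d (box lo hi).
  rewrite coef_sum (bigD1 (inord d))//= coefZ coefXn inordK// subSnn mulr1.
  rewrite ball_vol1 big1 ?addr0// => k kd.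
  rewrite coefZ coefXn (_ : (1 == _)%N = false) ?mulr0//.
  apply: contra_neqF kd => /eqP kd; apply: val_inj; rewrite /= inordK//.
  by move: (ltn_ord k) kd; lia.
pose L := (\prod_i a i)%:P + (2 * face_sum a) *: 'X.
pose U := \prod_i ((a i)%:P + 2%:R *: 'X).
have [U1 U0] := coef1_prod_linear a.
have LS (x : R) : 0 <= x -> L.[x] <= S.[x].
  move=> x0; have := vol_parallel_box_ge lohi x0.
  rewrite hS// lee_fin; apply: le_trans; rewrite /L !hornerE /a. lra.
have SU (x : R) : 0 <= x -> S.[x] <= U.[x].
  move=> x0; have := vol_parallel_box_le lohi x0.
  rewrite hS// lee_fin horner_prod => /le_trans; apply; rewrite le_eqVlt.
  by apply/orP/or_introl/eqP/eq_bigr => i _; rewrite hornerD hornerZ hornerX hornerC /a; ring.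
have L0 : L`_0 = \prod_i a i by rewrite /L coefD coefC coefZ coefX mulr0 addr0.
have S0 : S`_0 = \prod_i a i.
  apply/eqP; rewrite eq_le -{1}U0 -L0 -!horner_coef0 SU//= LS//.
have L1 : L`_1 = 2 * face_sum a by rewrite /L coefD coefC coefZ coefX mulr1 add0r.
have h1 := ler_coef1 LS (etrans L0 (esym S0)).
have h2 := ler_coef1 SU (etrans S0 (esym U0)).
by move: h1 h2; rewrite L1 S1 -/U U1; lra.
Qed.

End intrinsic_volume_of_boxes.

(** * Words and the positions of their cubes *)

Section words.
Context {d M : nat}.
Hypothesis M_gt0 : (0 < M)%N.
Local Notation letter := 'I_(M ^ d).

(** The last letter selects a child of the cube of the remaining word; extending at the end makes
    [big_words_recr] a sum over children. *)
Fixpoint words (n : nat) : seq (seq letter) :=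
  if n is m.+1 then [seq rcons s j | s <- words m, j <- enum letter]
  else [:: [::]].

Lemma mem_words n s : (s \in words n) = (size s == n).
Proof.
elim: n s => [|n IH] s /=; first by rewrite inE -size_eq0.
apply/allpairsP/eqP => [[[t j] /= [+ _ ->]]|].
  by rewrite IH size_rcons => /eqP ->.
case/lastP: s => // s j; rewrite size_rcons => -[sn].
by exists (s, j); rewrite /= IH sn eqxx mem_enum.
Qed.

Lemma uniq_words n : uniq (words n).
Proof.
elim: n => [//|n IH] /=; apply: allpairs_uniq => //; first exact: enum_uniq.
by move=> [s i] [t j] _ _ /= /rcons_inj[-> ->].
Qed.

Lemma big_words_recr (V : nmodType) n (F : seq letter -> V) :
  \sum_(s <- words n.+1) F s = \sum_(s <- words n) \sum_j F (rcons s j).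
Proof.
by rewrite /= big_allpairs_dep; apply: eq_bigr => s _; rewrite big_enum.
Qed.

Lemma size_words n : size (words n) = ((M ^ d) ^ n)%N.
Proof.
elim: n => [//|n IH] /=.
by rewrite size_allpairs IH size_enum_ord expnS mulnC.
Qed.

Definition digit (j : letter) (i : 'I_d) : nat := (j %/ M ^ i %% M)%N.

Lemma ltn_digit j i : (digit j i < M)%N.
Proof. by rewrite ltn_mod. Qed.

Lemma digit_inj j k : digit j =1 digit k -> j = k.
Proof.
move=> jk; suff modE : forall m, (m <= d)%N -> (j %% M ^ m = k %% M ^ m)%N.
  by apply: val_inj; have := modE d (leqnn d); rewrite !modn_small.
have divE (x m : nat) : (x %% M ^ m.+1 = x %/ M ^ m %% M * M ^ m + x %% M ^ m)%N.
  rewrite {1}(divn_eq x (M ^ m)) {1}(divn_eq (x %/ M ^ m) M) mulnDl -mulnA -expnS.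
  rewrite -addnA modnMDl modn_small// expnS.
  have Mm : (0 < M ^ m)%N by rewrite expn_gt0 M_gt0.
  have := ltn_pmod x Mm; have := ltn_pmod (x %/ M ^ m) M_gt0; nia.
elim=> [|m IH] md; first by rewrite !modn1.
by rewrite !divE IH ?(ltnW md)//; have := jk (Ordinal md); rewrite /digit /= => ->.
Qed.

(** By counting: the digits embed the letters into the functions from ['I_d] to ['I_M], and both
    sets have [M ^ d] elements. *)
Lemma digit_surj (z : 'I_d -> nat) : (forall i, (z i < M)%N) ->
  exists j, digit j =1 z.
Proof.
move=> zM; pose f (j : letter) : {ffun 'I_d -> 'I_M} :=
  [ffun i => Ordinal (ltn_digit j i)].
have f_inj : injective f.
  move=> j k /ffunP jk; apply: digit_inj => i.
  by have := jk i; rewrite !ffunE => -[].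
have : [ffun i => Ordinal (zM i)] \in codom f.
  by apply: inj_card_onto => //; rewrite card_ffun !card_ord.
by case/codomP => j /ffunP jz; exists j => i; have := jz i; rewrite !ffunE => -[].
Qed.

(** The lower corner of the cube of [s], in units of its side length [M^-(size s)]. *)
Definition position (s : seq letter) (i : 'I_d) : nat :=
  foldl (fun z j => z * M + digit j i)%N 0 s.

Lemma position_rcons s j i : position (rcons s j) i = (position s i * M + digit j i)%N.
Proof. by rewrite /position -cats1 foldl_cat. Qed.

(** Positions are built from the end of a word, whereas [cube] composes its maps from the head; this
    lemma reconciles the two directions. *)
Lemma position_cons s j i :
  position (j :: s) i = (digit j i * M ^ size s + position s i)%N.
Proof.
elim/last_ind: s => [|s k IH]; first by rewrite /position /= muln1 addn0.
by rewrite -rcons_cons !position_rcons IH size_rcons expnSr; ring.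
Qed.

Lemma ltn_position s i : (position s i < M ^ size s)%N.
Proof.
elim/last_ind: s => [//|s j IH]; rewrite position_rcons size_rcons expnSr.
by have := ltn_digit j i; move: IH; nia.
Qed.

Lemma position_inj s t : size s = size t -> position s =1 position t -> s = t.
Proof.
elim/last_ind: s t => [|s j IH] t; first by move/esym/size0nil.
case/lastP: t => [|t k]; first by rewrite size_rcons.
rewrite !size_rcons => -[st] e.
have eD i : (position s i = position t i) /\ (digit j i = digit k i).
  have := e i; rewrite !position_rcons => ei.
  split; first by have := congr1 (divn^~ M) ei;
    rewrite !divnMDl// !(divn_small (ltn_digit _ _)) !addn0.
  by have := congr1 (modn^~ M) ei; rewrite !modnMDl !(modn_small (ltn_digit _ _)).
by rewrite (IH t)// => [|i]; [congr rcons; apply: digit_inj => i|]; case: (eD i).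
Qed.

Lemma position_surj n (z : 'I_d -> nat) : (forall i, (z i < M ^ n)%N) ->
  exists2 s, size s = n & position s =1 z.
Proof.
elim: n z => [|n IH] z zM.
  by exists [::] => // i; have := zM i; rewrite ltnS leqn0 => /eqP ->.
have [i|s sn sz] := IH (fun i => z i %/ M)%N.
  by rewrite ltn_divLR// -expnSr.
have [i|j jz] := digit_surj (z := fun i => z i %% M)%N; first by rewrite ltn_mod.
exists (rcons s j); first by rewrite size_rcons sn.
by move=> i; rewrite position_rcons sz jz -divn_eq.
Qed.

(* For words of the same length: the cube of [t] is the translate of the cube
   of [s] by its side length in direction [l]. *)
Definition precedes (l : 'I_d) (s t : seq letter) : bool :=
  (position t l == (position s l).+1) &&
  [forall k, (k != l) ==> (position t k == position s k)].

Lemma precedesP l s t :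
  reflect (position t l = (position s l).+1 /\
           forall k, k != l -> position t k = position s k)
          (precedes l s t).
Proof.
apply: (iffP andP) => [[/eqP st /forallP h]|[/eqP st h]]; split=> //.
  by move=> k kl; apply/eqP; have := h k; rewrite kl.
by apply/forallP => k; apply/implyP => kl; rewrite h.
Qed.

Lemma precedes_injl l s s' t : size s = size s' ->
  precedes l s t -> precedes l s' t -> s = s'.
Proof.
move=> ss' /precedesP[e1 h1] /precedesP[e2 h2]; apply: position_inj => // k.
by have [->|kl] := eqVneq k l; [apply: succn_inj; rewrite -e1 -e2|rewrite -h1 // h2].
Qed.

Lemma precedes_injr l s t t' : size t = size t' ->
  precedes l s t -> precedes l s t' -> t = t'.
Proof.
move=> tt' /precedesP[e1 h1] /precedesP[e2 h2]; apply: position_inj => // k.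
by have [->|kl] := eqVneq k l; [rewrite e1 e2|rewrite h1 // h2].
Qed.

Lemma precedes_neq l s t : precedes l s t -> s != t.
Proof. by case/precedesP => st _; apply/eqP => e; move: st; rewrite e => /n_Sn. Qed.

Definition kept (y : seq letter -> bool) (s : seq letter) : bool :=
  all (fun m => y (take m s)) (iota 1 (size s)).

End words.

(** * Intrinsic volumes of unions of lattice cubes *)

Section lattice_cubes.
Context {R : realType} {d M : nat}.
Hypothesis M_gt0 : (0 < M)%N.
Local Notation letter := 'I_(M ^ d).

Let M_gt0R : 0 < M%:R :> R. Proof. by rewrite ltr0n. Qed.

Definition lattice_box (n : nat) (lo hi : 'I_d -> nat) : set 'rV[R]_d :=
  box (fun i => (lo i)%:R / M%:R ^+ n) (fun i => (hi i)%:R / M%:R ^+ n).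

Lemma cubeE (s : seq letter) :
  @cube R d M s = lattice_box (size s) (position s) (fun i => (position s i).+1).
Proof.
elim: s => [|j s IH].
  rewrite /cube /= image_id /lattice_box /box /unit_cube.
  by apply/seteqP; split => x /= h i; have := h i; rewrite !divr1.
have -> : @cube R d M (j :: s) = @phi R d M j @` @cube R d M s.
  by rewrite /cube /= image_comp.
rewrite IH.
have Mn : 0 < M%:R ^+ size s :> R by rewrite exprn_gt0.
have digE (i : 'I_d) : (j %/ M ^ i %% M)%N = digit j i by [].
have frac i (q : nat) : ((digit j i * M ^ size s + q)%N%:R / M%:R ^+ (size s).+1 =
    ((digit j i)%:R + q%:R / M%:R ^+ size s) / M%:R :> R).
  rewrite natrD natrM natrX exprS; field.
  by rewrite !gt_eqF.
apply/seteqP; split => [_ [y By <-] i|x Bx].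
  have := By i; rewrite mxE digE position_cons /= -addnS !frac.
  by move=> /andP[h1 h2]; rewrite !ler_pM2r ?invr_gt0//; apply/andP; split; lra.
exists (\row_i (x ord0 i * M%:R - (digit j i)%:R)).
  move=> i; rewrite mxE.
  have := Bx i; rewrite position_cons /= -addnS !frac ler_pdivrMr// ler_pdivlMr//.
  by move=> /andP[h1 h2]; apply/andP; split; lra.
by apply/rowP => i; rewrite !mxE digE subrK mulfK// gt_eqF.
Qed.

Lemma lattice_boxI n lo hi lo' hi' :
  lattice_box n lo hi `&` lattice_box n lo' hi' =
  lattice_box n (fun i => maxn (lo i) (lo' i)) (fun i => minn (hi i) (hi' i)).
Proof.
have Mn : 0 < (M%:R ^+ n)^-1 :> R by rewrite invr_gt0 exprn_gt0.
apply/seteqP; split => [x [B B'] i|x B].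
  have /andP[h1 h2] := B i; have /andP[h1' h2'] := B' i.
  by case: leqP => _; case: leqP => _; apply/andP.
split => i; have /andP[h1 h2] := B i; apply/andP; split.
- by apply: le_trans h1; rewrite ler_pM2r// ler_nat leq_maxl.
- by apply: (le_trans h2); rewrite ler_pM2r// ler_nat geq_minl.
- by apply: le_trans h1; rewrite ler_pM2r// ler_nat leq_maxr.
- by apply: (le_trans h2); rewrite ler_pM2r// ler_nat geq_minr.
Qed.

(* The facet is the lower one of the cube of [t] in direction [l]. *)
Definition facet_centre (n : nat) (l : 'I_d) (t : seq letter) : 'rV[R]_d :=
  \row_k (((position t k)%:R + (if k == l then 0 else 2^-1)) / M%:R ^+ n).

(* The centre of the cube on the other side of that facet; it lies outside
   the unit cube when the facet is on the boundary. *)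
Definition lower_centre (n : nat) (l : 'I_d) (t : seq letter) : 'rV[R]_d :=
  \row_k (((position t k)%:R + (if k == l then - 2^-1 else 2^-1)) / M%:R ^+ n).

Lemma ler_nat_half (a b : nat) : (a%:R <= b%:R + 2^-1 :> R) = (a <= b)%N.
Proof.
apply/idP/idP => [|ab]; last first.
  by rewrite -(ler_nat R) in ab; lra.
apply: contraTT; rewrite -ltnNge -ltNge -(ler_nat R) -[b.+1%:R]natr1; lra.
Qed.

Lemma half_ler_nat (a b : nat) : (a%:R + 2^-1 <= b%:R :> R) = (a < b)%N.
Proof.
apply/idP/idP => [|ab]; last first.
  by rewrite -(ler_nat R) -[a.+1%:R]natr1 in ab; lra.
by apply: contraTT; rewrite -leqNgt -ltNge -(ler_nat R); lra.
Qed.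

(** The condition in the directions other than [l], where both centres have the coordinate
    [z k + 1/2]; hence the strict upper bound. *)
Definition transverse (l : 'I_d) (lo hi z : 'I_d -> nat) : bool :=
  [forall k, (k != l) ==> (lo k <= z k < hi k)%N].

Lemma facet_centre_box n l t lo hi : lattice_box n lo hi (facet_centre n l t) <->
  transverse l lo hi (position t) && (lo l <= position t l <= hi l)%N.
Proof.
have Mn : 0 < (M%:R ^+ n)^-1 :> R by rewrite invr_gt0 exprn_gt0.
split=> [B|/andP[/forallP h hl] k].
  apply/andP; split; last first.
    by have := B l; rewrite mxE eqxx addr0 !ler_pM2r// !ler_nat.
  apply/forallP => k; apply/implyP => /negbTE kl.
  by have := B k; rewrite mxE kl !ler_pM2r// ler_nat_half half_ler_nat.
rewrite mxE !ler_pM2r//; case: eqVneq => [->|kl]; first by rewrite addr0 !ler_nat.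
by have := h k; rewrite kl ler_nat_half half_ler_nat.
Qed.

Lemma lower_centre_box n l t lo hi : lattice_box n lo hi (lower_centre n l t) <->
  transverse l lo hi (position t) && (lo l < position t l <= hi l)%N.
Proof.
have Mn : 0 < (M%:R ^+ n)^-1 :> R by rewrite invr_gt0 exprn_gt0.
have h1 (a b : nat) : (a%:R <= b%:R - 2^-1 :> R) = (a < b)%N.
  by rewrite -half_ler_nat; apply/idP/idP; lra.
have h2 (a b : nat) : (a%:R - 2^-1 <= b%:R :> R) = (a <= b)%N.
  by rewrite -ler_nat_half; apply/idP/idP; lra.
split=> [B|/andP[/forallP h hl] k].
  apply/andP; split; last first.
    by have := B l; rewrite mxE eqxx !ler_pM2r// h1 h2.
  apply/forallP => k; apply/implyP => /negbTE kl.
  by have := B k; rewrite mxE kl !ler_pM2r// ler_nat_half half_ler_nat.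
rewrite mxE !ler_pM2r//; case: eqVneq => [->|kl]; first by rewrite h1 h2.
by have := h k; rewrite kl ler_nat_half half_ler_nat.
Qed.

(* A valuation on all sets, being a signed counting measure.  On the lattice
   boxes with edges of 0 or 1 lattice steps it is [V_{d-1}] up to scaling, and
   these boxes are stable under intersection, so the two valuations agree on
   finite unions of cubes. *)
Definition facet_count (n : nat) (A : set 'rV[R]_d) : R :=
  \sum_l \sum_(t <- words n)
    (\1_A (facet_centre n l t) - \1_A (lower_centre n l t)).

Lemma facet_count0 n : facet_count n set0 = 0.
Proof.
by apply: big1 => l _; apply: big1 => t _; rewrite !indicE !in_set0 subrr.
Qed.

Lemma facet_countUI n A B :
  facet_count n (A `|` B) + facet_count n (A `&` B) =
  facet_count n A + facet_count n B.
Proof.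
rewrite -!big_split; apply: eq_bigr => l _ /=.
rewrite -!big_split; apply: eq_bigr => t _ /=.
have indUI x : \1_(A `|` B) x + \1_(A `&` B) x = \1_A x + \1_B x :> R.
  by rewrite !indicE in_setU in_setI; case: (x \in A); case: (x \in B) => /=; lra.
have := indUI (facet_centre n l t); have := indUI (lower_centre n l t); lra.
Qed.

End lattice_cubes.

Arguments lattice_box {R d} M n lo hi.
Arguments facet_count {R d} M n A.

Section lattice_unions.
Context {R : realType} {d M : nat}.
Hypothesis M_gt0 : (0 < M)%N.
Local Notation letter := 'I_(M ^ d).

Let Mn_gt0 n : 0 < M%:R ^+ n :> R. Proof. by rewrite exprn_gt0// ltr0n. Qed.

Lemma indic_iff (T : Type) (A : set T) (x : T) (b : bool) :
  (A x <-> b) -> \1_A x = b%:R :> R.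
Proof.
by move=> Ab; rewrite indicE; congr (nat_of_bool _)%:R; apply/idP/idP;
  rewrite inE => /Ab.
Qed.

(** In direction [l] only the word at the lower corner of the box can contribute, and it does so
    when all other edges have full length. The product on the right is then [(M^-n)^(d-1)], and it
    is 0 otherwise. *)
Lemma facet_count_box n (lo hi : 'I_d -> nat) : (forall i, (lo i < M ^ n)%N) ->
  (forall i, (lo i <= hi i <= (lo i).+1)%N) ->
  facet_count M n (lattice_box M n lo hi) = (M%:R ^+ n) ^+ d.-1 *
    face_sum (fun i => (hi i)%:R / M%:R ^+ n - (lo i)%:R / M%:R ^+ n) :> R.
Proof.
move=> loM lohi; have [t0 t0n t0lo] := position_surj M_gt0 loM.
rewrite /facet_count /face_sum mulr_sumr; apply: eq_bigr => l _.
pose full := [forall k, (k != l) ==> (hi k == (lo k).+1)].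
pose B : set 'rV[R]_d := lattice_box M n lo hi.
have tE t : t \in words n ->
    \1_B (facet_centre n l t) - \1_B (lower_centre n l t) =
    ((t == t0) && full)%:R :> R.
  rewrite mem_words => /eqP tn.
  rewrite (indic_iff (facet_centre_box M_gt0 n l t lo hi)).
  rewrite (indic_iff (lower_centre_box M_gt0 n l t lo hi)).
  have [/andP[/eqP tt0 /forallP fl]|nt0] := boolP ((t == t0) && full).
    have -> : transverse l lo hi (position t).
      apply/forallP => k; apply/implyP => kl; have := fl k; rewrite kl tt0 t0lo.
      by move=> /eqP ->; rewrite leqnn ltnSn.
    by rewrite tt0 t0lo ltnn leqnn; have /andP[-> _] := lohi l; rewrite subr0.
  have [/forallP tr|_] := boolP (transverse _ _ _ _); last by rewrite subrr.
  rewrite (leq_eqVlt (lo l)); case: eqP => [lot|_]; last by rewrite subrr.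
  exfalso; move: nt0; rewrite negb_and => /orP[/eqP|/negP]; apply.
    apply: (position_inj M_gt0); first by rewrite tn t0n.
    move=> k; rewrite t0lo; have [->//|kl] := eqVneq k l.
    by have := tr k; rewrite kl; have := lohi k; lia.
  apply/forallP => k; apply/implyP => kl.
  by have := tr k; rewrite kl; have := lohi k; lia.
rewrite (eq_big_seq _ tE) (bigD1_seq t0) ?uniq_words//=; last first.
  by rewrite mem_words t0n.
rewrite eqxx /= big1 ?addr0; last by move=> t /negbTE ->.
have aE k : (hi k)%:R / M%:R ^+ n - (lo k)%:R / M%:R ^+ n =
    (hi k == (lo k).+1)%:R / M%:R ^+ n :> R.
  rewrite -mulrBl; congr (_ / _); have := lohi k.
  rewrite [(hi k <= _)%N]leq_eqVlt; case: eqP => [->|_] /=.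
    by rewrite -natr1 addrAC subrr add0r.
  by rewrite ltnS -eqn_leq => /eqP ->; rewrite subrr.
under [X in _ * X]eq_bigr do rewrite aE.
rewrite big_split /= prodr_const mulrCA.
have -> : #|[pred j | j != l]| = d.-1 by rewrite cardC1 card_ord.
rewrite exprVn divff ?mulr1 ?gt_eqF ?exprn_gt0 ?ltr0n//.
rewrite -(big_morph (fun b : bool => b%:R : R) (id1 := 1) (op1 := *%R)
  (id2 := true) (op2 := andb))//; last first.
  by move=> [] []; rewrite /= ?mul1r ?mul0r.
by rewrite big_andE.
Qed.

(** [hi] may lie below [lo], which gives the empty set, and edges may degenerate. So the class
    contains the cubes and is closed under intersection; the bound on [lo] makes the lower corner
    the position of a word. *)
Definition is_lattice_box (n : nat) (A : set 'rV[R]_d) : Prop :=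
  exists lo hi, [/\ forall i, (lo i < M ^ n)%N,
    forall i, (hi i <= (lo i).+1)%N & A = lattice_box M n lo hi].

Lemma is_lattice_boxI n A B :
  is_lattice_box n A -> is_lattice_box n B -> is_lattice_box n (A `&` B).
Proof.
move=> [lo [hi [loM lohi ->]]] [lo' [hi' [loM' lohi' ->]]].
rewrite (lattice_boxI M_gt0); eexists _, _; split; last reflexivity => i /=.
  by move=> i /=; rewrite gtn_max loM loM'.
by move=> i /=; have := lohi i; have := lohi' i; lia.
Qed.

Variable V : nat -> set 'rV[R]_d -> R.
Hypothesis hV : intrinsic_volumes V.
Hypothesis d_gt0 : (0 < d)%N.

Lemma intrinsic_volume_lattice_box n A : is_lattice_box n A ->
  (M%:R ^+ n) ^+ d.-1 * V d.-1 A = facet_count M n A.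
Proof.
move=> [lo [hi [loM lohi ->]]].
have [lehi|] := pselect (forall i, (lo i <= hi i)%N).
  rewrite facet_count_box// => [|i]; last by rewrite lehi lohi.
  rewrite (intrinsic_volume_box hV)// => i.
  by rewrite ler_pM2r ?invr_gt0// ler_nat.
move=> /existsNP[i /negP]; rewrite -ltnNge => hilo.
have -> : lattice_box M n lo hi = set0 :> set 'rV[R]_d.
  rewrite -subset0 => x /(_ i) /andP[h1 /(le_trans h1)].
  by rewrite ler_pM2r ?invr_gt0// ler_nat leqNgt hilo.
by rewrite facet_count0 (intrinsic_volume_set0 hV (leq_pred d)) mulr0.
Qed.

Lemma polyconvex_lattice_boxes n m (B : nat -> set 'rV[R]_d) :
  (forall i, (i < m)%N -> is_lattice_box n (B i)) ->
  polyconvex (\big[setU/set0]_(i < m) B i).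
Proof.
move=> hB; exists m, (fun i : 'I_m => B i); split.
  move=> i; have [lo [hi [_ _ ->]]] := hB i (ltn_ord i).
  exact: convex_body_box.
rewrite -bigcup_mkord; apply/seteqP; split => x [i iI Bx];
  last by exists (i : nat) => //; exact: ltn_ord.
by exists (Ordinal iI).
Qed.

(** Both sides are additive. The first [m] boxes meet the last one in a union of [m] boxes of the
    same class, so the induction hypothesis, kept general in [B], covers the intersection as
    well. *)
Lemma intrinsic_volume_lattice_boxes n m (B : nat -> set 'rV[R]_d) :
  (forall i, (i < m)%N -> is_lattice_box n (B i)) ->
  (M%:R ^+ n) ^+ d.-1 * V d.-1 (\big[setU/set0]_(i < m) B i) =
  facet_count M n (\big[setU/set0]_(i < m) B i).
Proof.
elim: m B => [|m IH] B hB.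
  by rewrite !big_ord0 facet_count0 (intrinsic_volume_set0 hV (leq_pred d)) mulr0.
rewrite !big_ord_recr /=; set U := \big[setU/set0]_(i < m) B i.
have hB' i : (i < m)%N -> is_lattice_box n (B i) by move=> im; apply: hB; exact: ltnW.
have hBm := hB m (ltnSn m).
have UI : U `&` B m = \big[setU/set0]_(i < m) (B i `&` B m).
  by rewrite /U big_distrl.
have pBm : polyconvex (B m).
  by rewrite -(set0U (B m)); have := @polyconvex_lattice_boxes n 1 (fun=> B m);
    rewrite big_ord1 set0U; apply.
have := intrinsic_volumeUI hV (leq_pred d) (polyconvex_lattice_boxes hB') pBm.
have := facet_countUI (M := M) n U (B m).
have := IH _ hB'; have := intrinsic_volume_lattice_box hBm.
have := IH (fun i => B i `&` B m); rewrite -UI -/U.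
move=> /(_ (fun i im => is_lattice_boxI (hB' i im) hBm)).
set c := _ ^+ _; move=> e1 e2 e3 e4 /(congr1 ( *%R c)).
rewrite !mulrDr e1 e2 e3; move: e4; lra.
Qed.

End lattice_unions.

(** * Counting the facets of the percolation steps *)

Section percolation_count.
Context {R : realType} {d M : nat}.
Hypothesis M_gt0 : (0 < M)%N.
Local Notation letter := 'I_(M ^ d).

Lemma perc_stepE (T : Type) (Y : seq letter -> T -> bool) n w :
  perc_step Y n w =
  \bigcup_(s in [set s | s \in words n /\ kept (Y^~ w) s]) @cube R d M s.
Proof.
have keptP s : reflect (forall m, (1 <= m <= size s)%N -> Y (take m s) w)
    (kept (Y^~ w) s).
  apply: (iffP allP) => h m mn; apply: h; move: mn;
    by rewrite mem_iota add1n ltnS.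
apply/seteqP; split => x [s].
  move=> /= hs xs; exists (s : seq _) => //=.
  by split; [rewrite mem_words size_tuple|apply/keptP; rewrite size_tuple].
move=> [/=]; rewrite mem_words => sn /keptP hs xs.
by exists (Tuple sn) => //= m; rewrite -(eqP sn); exact: hs.
Qed.

(** The centre of the lower facet of [t] lies in [F] iff [t] or the cube below it satisfies [K]; the
    lower centre lies in [F] iff the cube below does. The difference is [K t] less the indicator
    that both satisfy [K], and the cube below is unique. *)
Lemma facet_count_cubes n (K : pred (seq letter)) (F : set 'rV[R]_d) :
  F = \bigcup_(s in [set s | s \in words n /\ K s]) @cube R d M s ->
  facet_count M n F =
  d%:R * (\sum_(s <- words n) (K s)%:R) -
  \sum_l \sum_(s <- words n) \sum_(t <- words n)
     (precedes l s t)%:R * ((K s)%:R * (K t)%:R).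
Proof.
move=> FE.
have -> : d%:R * (\sum_(s <- words n) (K s)%:R) =
    \sum_(l < d) \sum_(s <- @words d M n) (K s)%:R :> R.
  by rewrite sumr_const card_ord mulr_natl.
rewrite -sumrB; apply: eq_bigr => l _; rewrite exchange_big -sumrB /=.
apply: eq_big_seq => t tn.
pose prev := has (fun s => precedes l s t && K s) (words n).
have -> : \sum_(s <- words n) (precedes l s t)%:R * ((K s)%:R * (K t)%:R) =
    (K t && prev)%:R :> R.
  have [/hasP[s sn /andP[st Ks]]|/hasPn nprev] := boolP prev.
    rewrite (bigD1_seq s) ?uniq_words//= st Ks !mul1r big_seq_cond big1 ?addr0 ?andbT//.
    move=> s' /andP[s'n ss']; case: (boolP (precedes l s' t)) => [s't|]; last first.
      by rewrite mul0r.
    move: ss'; rewrite (precedes_injl M_gt0 _ s't st) ?eqxx//.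
    by move: s'n sn; rewrite !mem_words => /eqP -> /eqP ->.
  rewrite andbF big_seq big1// => s sn; have := nprev s sn.
  by rewrite negb_and => /orP[/negbTE ->|/negbTE ->]; rewrite ?mul0r ?mulr0.
have inF x : F x <-> exists2 s, s \in words n & K s /\
    lattice_box M n (position s) (fun i => (position s i).+1) x.
  rewrite FE; split => [[s /= [sn Ks]]|[s sn [Ks xs]]].
    by rewrite cubeE// => xs; exists s => //; rewrite -(eqP (etrans (esym (mem_words _ _)) sn)).
  by exists s => //; rewrite cubeE// (eqP (etrans (esym (mem_words _ _)) sn)).
have transE s : transverse l (position s) (fun i => (position s i).+1) (position t) <->
    forall k, k != l -> position t k = position s k.
  split=> [/forallP h k kl|h].
    by have := h k; rewrite kl /= ltnS -eqn_leq => /eqP.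
  by apply/forallP => k; apply/implyP => kl; rewrite h// leqnn ltnSn.
rewrite (@indic_iff _ _ _ _ (K t || prev)); last first.
  split=> [/inF[s sn [Ks /(facet_centre_box M_gt0) /andP[/transE tr lt]]]|].
    move: lt; rewrite leq_eqVlt => /andP[/orP[/eqP e _|lt1 lt2]].
      rewrite (_ : t = s) ?Ks//; apply: (position_inj M_gt0).
        by move: tn sn; rewrite !mem_words => /eqP -> /eqP ->.
      by move=> k; have [->|/tr] := eqVneq k l.
    apply/orP; right; apply/hasP; exists s => //; rewrite Ks andbT.
    by apply/precedesP; split=> //; apply/eqP; rewrite eqn_leq lt2.
  move=> /orP[Kt|/hasP[s sn /andP[/precedesP[e tr] Ks]]]; apply/inF.
    exists t => //; split=> //; apply/(facet_centre_box M_gt0).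
    by apply/andP; split; [apply/transE|rewrite leqnn leqnSn].
  exists s => //; split=> //; apply/(facet_centre_box M_gt0).
  by apply/andP; split; [apply/transE|rewrite e leqnn leqnSn].
rewrite (@indic_iff _ _ _ _ prev); last first.
  split=> [/inF[s sn [Ks /(lower_centre_box M_gt0) /andP[/transE tr lt]]]|].
    apply/hasP; exists s => //; rewrite Ks andbT.
    by apply/precedesP; split=> //; apply/eqP; rewrite eqn_leq andbC.
  move=> /hasP[s sn /andP[/precedesP[e tr] Ks]]; apply/inF.
  exists s => //; split=> //; apply/(lower_centre_box M_gt0).
  by apply/andP; split; [apply/transE|rewrite e leqnn].
by case: (K t); case: prev; rewrite /= ?subrr.
Qed.

Lemma intrinsic_volume_perc_step V (T : Type) (Y : seq letter -> T -> bool) n w :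
  intrinsic_volumes V -> (0 < d)%N ->
  (M%:R ^+ n) ^+ d.-1 * V d.-1 (perc_step Y n w) =
  d%:R * (\sum_(s <- words n) (kept (Y^~ w) s)%:R) -
  \sum_l \sum_(s <- words n) \sum_(t <- words n) (precedes l s t)%:R *
     ((kept (Y^~ w) s)%:R * (kept (Y^~ w) t)%:R) :> R.
Proof.
move=> hV d_gt0; rewrite -(facet_count_cubes (perc_stepE Y n w)).
pose L := [seq s <- words n | kept (Y^~ w) s].
have -> : perc_step Y n w =
    \big[setU/set0]_(i < size L) @cube R d M (nth [::] L i).
  rewrite perc_stepE -(bigcup_mkord _ (fun i => @cube R d M (nth [::] L i))).
  apply/seteqP; split => x [].
    move=> s /= [sn Ks] xs; have sL : s \in L by rewrite mem_filter Ks.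
    by exists (index s L); rewrite /= ?index_mem// nth_index.
  move=> i /= iL xi; exists (nth [::] L i) => //=.
  by have := mem_nth [::] iL; rewrite mem_filter => /andP[].
apply: (intrinsic_volume_lattice_boxes M_gt0 hV d_gt0
  (B := fun i => @cube R d M (nth [::] L i))) => i iL.
have := mem_nth [::] iL; rewrite mem_filter mem_words => /andP[_ /eqP sn].
rewrite cubeE// sn; set s := nth _ _ _ in sn *.
exists (position s), (fun k => (position s k).+1); split=> // k.
by have := ltn_position M_gt0 s k; rewrite sn.
Qed.

End percolation_count.

(** * Moments of the numbers of kept cubes and of kept adjacent pairs *)

Section prefixes.
Context {A : eqType}.

Definition prefixes (s : seq A) : seq (seq A) :=
  [seq take m s | m <- iota 1 (size s)].

(** The distinct labels that decide whether all words of [L] are kept; the empty word carries no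
    label. *)
Definition prefix_closure (L : seq (seq A)) : seq (seq A) :=
  undup (flatten [seq prefixes s | s <- L]).

Lemma mem_prefixes s u : (u \in prefixes s) = (u != [::]) && prefix u s.
Proof.
apply/mapP/andP => [[m]|[u0 us]].
  rewrite mem_iota => /andP[m1 ms] ->; split; last exact: prefix_take.
  by rewrite -size_eq0 size_take; case: ltnP; lia.
exists (size u); last by apply/esym/eqP; rewrite -prefixE.
by rewrite mem_iota add1n ltnS lt0n size_eq0 u0; exact: size_prefix.
Qed.

Lemma mem_prefix_closure L u :
  (u \in prefix_closure L) = (u != [::]) && has (prefix u) L.
Proof.
rewrite mem_undup; apply/flatten_mapP/andP => [[s sL]|[u0 /hasP[s sL us]]].
  by rewrite mem_prefixes => /andP[u0 us]; split=> //; apply/hasP; exists s.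
by exists s => //; rewrite mem_prefixes u0.
Qed.

End prefixes.

(** * Probabilities that finitely many words are kept *)

Section prefix_weight.
Context {R : realType} {A : eqType} (p : R).
Implicit Types L : seq (seq A).

(* The probability that all the words of [L] are kept. *)
Definition weight (L : seq (seq A)) : R := p ^+ size (prefix_closure L).

Lemma eq_weight L L' :
  (forall u, u != [::] -> has (prefix u) L = has (prefix u) L') ->
  weight L = weight L'.
Proof.
move=> LL'; congr (_ ^+ _); apply: perm_size; apply: uniq_perm;
  rewrite ?undup_uniq// => u.
by rewrite !mem_prefix_closure; case: eqP => //= /eqP/LL' ->.
Qed.

Lemma weight_eq_mem L L' : L =i L' -> weight L = weight L'.
Proof. by move=> LL'; apply: eq_weight => u _; exact: eq_has_r. Qed.

Lemma weight_nil : weight [::] = 1.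
Proof. by rewrite /weight /= expr0. Qed.

Lemma weight_cons_nil L : weight ([::] :: L) = weight L.
Proof. by apply: eq_weight => -[]. Qed.

Lemma weight_cons_rcons s j L :
  ~~ has (prefix (rcons s j)) L -> weight (rcons s j :: L) = p * weight (s :: L).
Proof.
move=> sjL; rewrite /weight -exprS; congr (_ ^+ _).
rewrite -[RHS]/(size (rcons s j :: prefix_closure (s :: L))).
apply: perm_size; apply: uniq_perm; rewrite ?undup_uniq//=.
  rewrite undup_uniq andbT mem_prefix_closure /= (negbTE sjL) orbF.
  by rewrite negb_and; apply/orP; right; apply/negP => /size_prefix;
    rewrite size_rcons ltnn.
have pre u : prefix u (rcons s j) = (u == rcons s j) || prefix u s.
  apply/idP/orP => [|[/eqP ->|us]]; last 2 first.
  - exact: prefix_refl.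
  - by apply: prefix_trans us (prefix_rcons _ _).
  rewrite !prefixE => /eqP e; have [us|us] := leqP (size u) (size s).
    by right; rewrite -{2}e -cats1 takel_cat.
  by left; rewrite -{1}e take_oversize// size_rcons.
move=> u; rewrite inE !mem_prefix_closure /= pre -orbA.
by have [->|_] := eqVneq u (rcons s j); first by case: (s).
Qed.

Lemma weight1 s : weight [:: s] = p ^+ size s.
Proof.
elim/last_ind: s => [|s j IH]; first by rewrite weight_cons_nil weight_nil.
by rewrite weight_cons_rcons// IH size_rcons exprS.
Qed.

(** No word of [L] is longer than [u], so [u] could be a prefix of one only by belonging to [L]. Its
    last label is therefore new and contributes a factor [p]. *)
Lemma weight_cons_par n (u : seq A) L : size u = n.+1 ->
  (forall s, s \in L -> (size s <= n.+1)%N) -> u \notin L ->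
  weight (u :: L) = p * weight (take n u :: L).
Proof.
case/lastP: u => // u j; rewrite size_rcons => -[un] Ln ujL.
rewrite -cats1 take_size_cat ?cats1 ?un// weight_cons_rcons//.
apply/hasPn => s sL; apply/negP => /[dup] /size_prefix.
rewrite size_rcons un => ns; rewrite prefixE size_rcons un => /eqP.
by rewrite take_oversize ?Ln// => e; move: ujL; rewrite -e sL.
Qed.

Hypothesis p01 : 0 <= p <= 1.

Lemma weight_ge0 L : 0 <= weight L.
Proof. by case/andP: p01 => p0 _; exact: exprn_ge0. Qed.

Lemma weight_sub L L' : {subset L <= L'} -> weight L' <= weight L.
Proof.
move=> LL'; apply: ler_wiXn2l; [by case/andP: p01|by case/andP: p01|].
apply: uniq_leq_size; first exact: undup_uniq.
move=> u; rewrite !mem_prefix_closure => /andP[-> /hasP[s /LL' sL' us]] /=.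
by apply/hasP; exists s.
Qed.

End prefix_weight.

(** * Adjacent pairs among the children of cubes *)

Section kernels.
Context {R : realType} {d M : nat}.
Hypothesis M_gt0 : (0 < M)%N.
Local Notation letter := 'I_(M ^ d).

(** Summed against [K_s K_t], with [K_s] the indicator that [s] is kept, the kernels [same_cube] and
    [adjacent_cubes] give [N_n] and [A_n]. The common shape lets one argument treat both. *)
Definition same_cube (s t : seq letter) : R := (s == t)%:R.

Definition adjacent_cubes (s t : seq letter) : R := \sum_l (precedes l s t)%:R.

Lemma same_cube_ge0 s t : 0 <= same_cube s t.
Proof. exact: ler0n. Qed.

Lemma adjacent_cubes_ge0 s t : 0 <= adjacent_cubes s t.
Proof. by apply: sumr_ge0 => l _; exact: ler0n. Qed.

(* Neighbouring children of one cube. *)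
Definition inner_step (l : 'I_d) (i j : letter) : bool :=
  (digit j l == (digit i l).+1) &&
  [forall k, (k != l) ==> (digit j k == digit i k)].

(* Neighbouring children of two neighbouring cubes. *)
Definition outer_step (l : 'I_d) (i j : letter) : bool :=
  [&& digit i l == M.-1, digit j l == 0%N &
  [forall k, (k != l) ==> (digit j k == digit i k)]].

(** Adding one to a number in base [M] either raises the last digit, and the parents coincide, or
    carries from [M - 1] to 0, and the parents are neighbours. *)
Lemma precedes_rcons l s t i j : size s = size t ->
  precedes l (rcons s i) (rcons t j) =
  ((s == t) && inner_step l i j) || (precedes l s t && outer_step l i j).
Proof.
move=> st.
have dm x y k (v w : letter) : (x * M + digit v k = y * M + digit w k)%N <->
    x = y /\ digit v k = digit w k.
  split=> [e|[-> -> //]]; split.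
    by have := congr1 (divn^~ M) e; rewrite !divnMDl// !(divn_small (ltn_digit _ _ _)) ?addn0.
  by have := congr1 (modn^~ M) e; rewrite !modnMDl !(modn_small (ltn_digit _ _ _)).
have hi := ltn_digit M_gt0 i l; have hj := ltn_digit M_gt0 j l.
apply/precedesP/orP => [[el ek]|[/andP[/eqP <- /andP[/eqP e /forallP h]]|
    /andP[/precedesP[e1 h1] /and3P[/eqP i1 /eqP j0 /forallP h]]]].
- have ek' k : k != l -> position t k = position s k /\ digit j k = digit i k.
    by move=> kl; apply/dm; rewrite -!position_rcons; exact: ek.
  have fk : [forall k, (k != l) ==> (digit j k == digit i k)].
    by apply/forallP => k; apply/implyP => /ek'[_ ->].
  move: el; rewrite !position_rcons => el.
  have [iM|iM] := eqVneq (digit i l) M.-1.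
    right; have e : (position t l * M + digit j l = (position s l).+1 * M + 0)%N.
      by move: el; rewrite iM; nia.
    have tl : position t l = (position s l).+1.
      by have := congr1 (divn^~ M) e; rewrite !divnMDl// (divn_small hj) div0n !addn0.
    have jl : digit j l = 0%N.
      by have := congr1 (modn^~ M) e; rewrite !modnMDl (modn_small hj) mod0n.
    rewrite /outer_step iM jl !eqxx fk !andbT; apply/precedesP; split=> // k.
    by case/ek'.
  left; have iM' : ((digit i l).+1 < M)%N by move: hi iM; lia.
  have e : (position t l * M + digit j l = position s l * M + (digit i l).+1)%N.
    by rewrite el addnS.
  have tl : position t l = position s l.
    by have := congr1 (divn^~ M) e;
      rewrite !divnMDl// (divn_small hj) (divn_small iM') !addn0.
  have jl : digit j l = (digit i l).+1.
    by have := congr1 (modn^~ M) e; rewrite !modnMDl (modn_small hj) (modn_small iM').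
  rewrite /inner_step jl eqxx fk !andbT; apply/eqP/(position_inj M_gt0) => // k.
  by have [->//|/ek'[]] := eqVneq k l.
- split=> [|k kl]; rewrite !position_rcons; first by rewrite e addnS.
  by have := h k; rewrite kl => /eqP ->.
- split=> [|k kl]; rewrite !position_rcons.
    by rewrite e1 j0 i1; move: M_gt0; nia.
  by rewrite h1//; have := h k; rewrite kl => /eqP ->.
Qed.

Lemma card_digit (l : 'I_d) (x : nat) : (x < M)%N ->
  \sum_(i : letter) (digit i l == x)%:R = M%:R ^+ d.-1 :> R.
Proof.
move=> xM; pose f (j : letter) : {ffun 'I_d -> 'I_M} :=
  [ffun i => Ordinal (ltn_digit M_gt0 j i)].
have f_inj : injective f.
  move=> j k /ffunP jk; apply: (digit_inj M_gt0) => i.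
  by have := jk i; rewrite !ffunE => -[].
have f_bij : bijective f by apply: inj_card_bij; rewrite // card_ffun !card_ord.
(* The indicator is a product over the coordinates with a constraint at [l] only, so its sum over
   all digit vectors factors: 1 at [l] and [M] at each other coordinate. *)
pose F (k : 'I_d) (y : 'I_M) : R := ((k == l) ==> (y == x :> nat))%:R.
transitivity (\sum_(g : {ffun 'I_d -> 'I_M}) \prod_k F k (g k)).
  rewrite (reindex f) /=; last exact: onW_bij.
  apply: eq_bigr => j _; rewrite (bigD1 l)//= big1 ?mulr1; last first.
    by move=> k /negbTE kl; rewrite /F kl.
  by rewrite /F eqxx ffunE.
rewrite -(bigA_distr_bigA F) (bigD1 l)//= [X in _ * X](eq_bigr (fun=> M%:R)).
  rewrite prodr_const cardC1 card_ord [X in X * _](_ : _ = 1) ?mul1r//.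
  rewrite (bigD1 (Ordinal xM))//= /F !eqxx /= big1 ?addr0// => y yx.
  rewrite (_ : (_ == _) = false)//; apply/negbTE.
  by apply: contra yx => /eqP yx; apply/eqP/val_inj.
move=> k kl; rewrite (eq_bigr (fun=> 1)) ?sumr_const ?card_ord// => y _.
by rewrite /F (negbTE kl).
Qed.

Lemma sum_unique (P : pred letter) (z : 'I_d -> nat) : (forall k, (z k < M)%N) ->
  (forall j, P j <-> digit j =1 z) -> \sum_j (P j)%:R = 1 :> R.
Proof.
move=> zM Pz; have [j0 j0z] := digit_surj M_gt0 zM.
rewrite (bigD1 j0)//= big1 ?addr0 => [|j jj0].
  by have /Pz -> := j0z.
have [/Pz jz|//] := boolP (P j).
by case/eqP: jj0; apply: (digit_inj M_gt0) => k; rewrite jz j0z.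
Qed.

Lemma sum_outer_step l : \sum_i \sum_j (outer_step l i j)%:R = M%:R ^+ d.-1 :> R.
Proof.
rewrite -(@card_digit l M.-1); last by rewrite ltn_predL.
apply: eq_bigr => i _; have [il|il] := eqVneq (digit i l) M.-1; last first.
  by rewrite big1// => j _; rewrite /outer_step (negbTE il).
apply: (@sum_unique _ (fun k => if k == l then 0%N else digit i k)) => [k|j].
  by case: ifP => // _; exact: ltn_digit.
rewrite /outer_step il eqxx /=; split=> [/andP[/eqP jl /forallP h] k|h].
  by case: eqVneq => [->//|kl]; have := h k; rewrite kl => /eqP.
rewrite h eqxx; apply/forallP => k; apply/implyP => kl.
by rewrite h (negbTE kl).
Qed.

(** Every letter has exactly one upper neighbour in the same parent, except the [M ^ (d - 1)]
    letters whose digit in direction [l] is maximal. *)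
Lemma sum_inner_step l :
  \sum_i \sum_j (inner_step l i j)%:R = (M%:R - 1) * M%:R ^+ d.-1 :> R.
Proof.
have d_gt0 : (0 < d)%N by case: (d) l => [[]|].
rewrite mulrBl mul1r -exprS prednK// -(@card_digit l M.-1); last by rewrite ltn_predL.
transitivity (\sum_(i : letter) (1 - (digit i l == M.-1)%:R : R)); last first.
  by rewrite sumrB sumr_const card_ord natrX.
apply: eq_bigr => i _; have [il|il] := eqVneq (digit i l) M.-1.
  rewrite subrr big1// => j _; rewrite /inner_step il.
  by rewrite prednK// ltn_eqF//; exact: ltn_digit.
have hi := ltn_digit M_gt0 i l.
rewrite subr0.
apply: (@sum_unique _ (fun k => if k == l then (digit i l).+1 else digit i k)) => [k|j].
  by case: ifP => _; [move: hi il; lia|exact: ltn_digit].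
rewrite /inner_step; split=> [/andP[/eqP jl /forallP h] k|h].
  by case: eqVneq => [->//|kl]; have := h k; rewrite kl => /eqP.
rewrite h !eqxx; apply/forallP => k; apply/implyP => kl.
by rewrite h (negbTE kl).
Qed.

End kernels.

(** * Kernel sums and their one-level recursions *)

Section kernel_sums.
Context {R : realType} {d M : nat}.
Hypothesis M_gt0 : (0 < M)%N.
Hypothesis d_gt0 : (0 < d)%N.
Local Notation letter := 'I_(M ^ d).
Local Notation kernel := (seq letter -> seq letter -> R).

Definition kernel_sum (c : kernel) (n : nat) (F : kernel) : R :=
  \sum_(s <- words n) \sum_(t <- words n) c s t * F s t.

Lemma take_rcons (n : nat) (s : seq letter) i :
  s \in words n -> take n (rcons s i) = s.
Proof. by rewrite mem_words => /eqP <-; rewrite -cats1 take_size_cat. Qed.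

Lemma eq_kernel_sum c n F G :
  {in words n &, forall s t, c s t != 0 -> F s t = G s t} ->
  kernel_sum c n F = kernel_sum c n G.
Proof.
move=> FG; rewrite /kernel_sum; apply: eq_big_seq => s sn.
apply: eq_big_seq => t tn; have [->|cst] := eqVneq (c s t) 0.
  by rewrite !mul0r.
by rewrite FG.
Qed.

Lemma kernel_sumD c n F G :
  kernel_sum c n (fun s t => F s t + G s t) = kernel_sum c n F + kernel_sum c n G.
Proof.
rewrite /kernel_sum -big_split; apply: eq_bigr => s _ /=; rewrite -big_split.
by apply: eq_bigr => t _ /=; rewrite mulrDr.
Qed.

Lemma kernel_sumZ c n k F :
  kernel_sum c n (fun s t => k * F s t) = k * kernel_sum c n F.
Proof.
rewrite /kernel_sum mulr_sumr; apply: eq_bigr => s _; rewrite mulr_sumr.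
by apply: eq_bigr => t _; rewrite mulrCA.
Qed.

Lemma kernel_sumB c n F G :
  kernel_sum c n (fun s t => F s t - G s t) = kernel_sum c n F - kernel_sum c n G.
Proof.
rewrite -[- kernel_sum c n G]mulN1r -kernel_sumZ -kernel_sumD.
by apply: eq_kernel_sum => s t _ _ _; rewrite mulN1r.
Qed.

Lemma kernel_sum_same_cube n F :
  kernel_sum same_cube n F = \sum_(s <- words n) F s s.
Proof.
apply: eq_big_seq => s sn; rewrite (bigD1_seq s) ?uniq_words//=.
rewrite /same_cube eqxx mul1r big1 ?addr0// => t ts.
by rewrite eq_sym (negbTE ts) mul0r.
Qed.

Lemma kernel_sum_same_cubeS n F :
  kernel_sum same_cube n.+1 (fun s t => F (take n s) (take n t)) =
  M%:R ^+ d * kernel_sum same_cube n F.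
Proof.
rewrite !kernel_sum_same_cube big_words_recr mulr_sumr; apply: eq_big_seq => s sn.
under eq_bigr do rewrite take_rcons//.
by rewrite sumr_const card_ord -natrX mulr_natl.
Qed.

Lemma kernel_sum_adjacent_cubes n F : kernel_sum adjacent_cubes n F =
  \sum_l \sum_(s <- words n) \sum_(t <- words n) (precedes l s t)%:R * F s t.
Proof.
rewrite exchange_big; apply: eq_bigr => s _; rewrite exchange_big.
by apply: eq_bigr => t _; rewrite /adjacent_cubes mulr_suml.
Qed.

(** A cube has [d (M - 1) M^(d-1)] adjacent pairs of children, and a pair of adjacent cubes has
    [M^(d-1)] pairs of children across the common facet. *)
Lemma kernel_sum_adjacent_cubesS n F :
  kernel_sum adjacent_cubes n.+1 (fun s t => F (take n s) (take n t)) =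
  M%:R ^+ d.-1 * (d%:R * (M%:R - 1) * kernel_sum same_cube n F +
                  kernel_sum adjacent_cubes n F).
Proof.
rewrite mulrDr !kernel_sum_adjacent_cubes kernel_sum_same_cube.
have -> : M%:R ^+ d.-1 * (d%:R * (M%:R - 1) * \sum_(s <- words n) F s s) =
    \sum_(l < d) ((M%:R - 1) * M%:R ^+ d.-1 * \sum_(s <- words n) F s s).
  by rewrite sumr_const card_ord -[RHS]mulr_natl; ring.
rewrite [X in _ + X]mulr_sumr -big_split; apply: eq_bigr => l _ /=.
rewrite big_words_recr !mulr_sumr -big_split; apply: eq_big_seq => s sn /=.
under eq_bigr do rewrite big_words_recr.
rewrite exchange_big /=.
transitivity (\sum_(t <- words n) ((s == t)%:R * ((M%:R - 1) * M%:R ^+ d.-1) * F s t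
    + M%:R ^+ d.-1 * ((precedes l s t)%:R * F s t))); last first.
  rewrite big_split /= -mulr_sumr; congr (_ + _).
  rewrite (bigD1_seq s) ?uniq_words//= eqxx mul1r big1 ?addr0// => t ts.
  by rewrite eq_sym (negbTE ts) !mul0r.
apply: eq_big_seq => t tn.
have st : size s = size t by move: sn tn; rewrite !mem_words => /eqP -> /eqP ->.
rewrite -(sum_inner_step M_gt0 l) -(sum_outer_step M_gt0 l).
have -> : (s == t)%:R * (\sum_(i : letter) \sum_(j : letter) (inner_step l i j)%:R) * F s t +
    (\sum_(i : letter) \sum_(j : letter) (outer_step l i j)%:R) * ((precedes l s t)%:R * F s t) =
    \sum_(i : letter) \sum_(j : letter) ((s == t)%:R * (inner_step l i j)%:R * F s t +
     (outer_step l i j)%:R * ((precedes l s t)%:R * F s t)).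
  under [RHS]eq_bigr do rewrite big_split.
  rewrite big_split /=; congr (_ + _).
    rewrite mulr_sumr mulr_suml; apply: eq_bigr => i _.
    by rewrite mulr_sumr mulr_suml.
  by rewrite mulr_suml; apply: eq_bigr => i _; rewrite mulr_suml.
apply: eq_bigr => i _; apply: eq_bigr => j _.
rewrite !take_rcons// precedes_rcons//.
(* Adjacent words are distinct, so the two alternatives of [precedes_rcons] exclude each other and
   the disjunction turns into a sum. *)
have [stE|_] := eqVneq s t; last first.
  by case: (precedes l s t); case: (outer_step l i j) => /=; ring.
have -> : precedes l s t = false.
  by apply/negP => /precedes_neq; rewrite stE eqxx.
by case: (inner_step l i j) => /=; ring.
Qed.

(** Bounds on row and column sums, uniform in the level; they control how many pairs contain a given
    word. *)
Definition bounded_kernel (D : R) (c : kernel) : Prop :=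
  forall n s, s \in words n ->
    \sum_(t <- words n) c s t <= D /\ \sum_(t <- words n) c t s <= D.

(** The true bound is 1; it is weakened to [d] so that both kernels share one constant. *)
Lemma bounded_same_cube : bounded_kernel d%:R same_cube.
Proof.
have d1 : 1 <= d%:R :> R by rewrite ler1n.
move=> n s sn; rewrite /same_cube; split;
  rewrite (bigD1_seq s) ?uniq_words//= eqxx big1 ?addr0// => t ts.
  by rewrite eq_sym (negbTE ts).
by rewrite (negbTE ts).
Qed.

Lemma sum_le1 (P : pred (seq letter)) (n : nat) :
  {in words n &, forall s t, P s -> P t -> s = t} ->
  \sum_(t <- words n) (P t)%:R <= 1 :> R.
Proof.
move=> P1; have [/hasP[s sn Ps]|/hasPn nP] := boolP (has P (words n)); last first.
  by rewrite big_seq big1 ?ler01// => t /nP/negbTE ->.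
rewrite (bigD1_seq s) ?uniq_words//= Ps big_seq_cond big1 ?addr0// => t /andP[tn ts].
by have [/(P1 _ _ tn sn)/(_ Ps) e|//] := boolP (P t); rewrite e eqxx in ts.
Qed.

Lemma bounded_adjacent_cubes : bounded_kernel d%:R adjacent_cubes.
Proof.
have sizeE n : {in @words d M n &, forall s t, size s = size t}.
  by move=> s t; rewrite !mem_words => /eqP -> /eqP ->.
have dE : d%:R = \sum_(l < d) 1 :> R by rewrite sumr_const card_ord.
move=> n s sn; rewrite /adjacent_cubes; split; rewrite exchange_big dE;
    apply: ler_sum => l _; apply: sum_le1 => t t' tn t'n.
  by apply: precedes_injr => //; exact: sizeE tn t'n.
by apply: precedes_injl => //; exact: sizeE tn t'n.
Qed.

End kernel_sums.

Section moments.
Context {R : realType} {d M : nat}.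
Hypothesis M_gt0 : (0 < M)%N.
Hypothesis d_gt0 : (0 < d)%N.
Variable p : R.
Local Notation letter := 'I_(M ^ d).
Local Notation kernel := (seq letter -> seq letter -> R).
Local Notation same_cube := (@same_cube R d M).
Local Notation adjacent_cubes := (@adjacent_cubes R d M).

(* With [K_s] the indicator that [s] is kept: the expectation of
   [prod_(u in U) K_u * sum_(s, t) c(s, t) K_s K_t], over words of length [n]. *)
Definition moment (c : kernel) (n : nat) (U : seq (seq letter)) : R :=
  kernel_sum c n (fun s t => weight p (s :: t :: U)).

Definition moment2 (c : kernel) (n : nat) (c' : kernel) (k : nat) : R :=
  kernel_sum c n (fun s t => moment c' k [:: s; t]).

(** [x] is the probability of the last labels of [s] and [t]: one label for [same_cube], two for
    [adjacent_cubes]. It factors out when no word of [U] uses these labels. *)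
Definition splits_off (c : kernel) (x : R) : Prop :=
  forall n s t (U : seq (seq letter)), s \in words n.+1 -> t \in words n.+1 ->
    c s t != 0 -> (forall u, u \in U -> (size u <= n.+1)%N) ->
    s \notin U -> t \notin U ->
    weight p (s :: t :: U) = x * weight p (take n s :: take n t :: U).

Lemma weight_dup s (U : seq (seq letter)) : weight p (s :: s :: U) = weight p (s :: U).
Proof. by apply: weight_eq_mem => u; rewrite !inE orbA orbb. Qed.

Lemma weight_swap s t (U : seq (seq letter)) :
  weight p (s :: t :: U) = weight p (t :: s :: U).
Proof. by apply: weight_eq_mem => u; rewrite !inE orbCA. Qed.

Lemma splits_off_same_cube : splits_off same_cube p.
Proof.
move=> n s t U; rewrite mem_words => /eqP sn _ st Un sU _.
have {st}<- : s = t by apply/eqP; move: st; rewrite /same_cube; case: (s == t); rewrite ?eqxx.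
by rewrite !weight_dup (weight_cons_par _ (n := n)).
Qed.

Lemma splits_off_adjacent_cubes : splits_off adjacent_cubes (p ^+ 2).
Proof.
move=> n s t U; rewrite !mem_words => /eqP sn /eqP tn cst Un sU tU.
have st : s != t.
  apply: contra_neq cst => ->; apply: big1 => l _.
  by case: (boolP (precedes l t t)) => // /precedes_neq; rewrite eqxx.
have tUn u : u \in t :: U -> (size u <= n.+1)%N.
  by rewrite inE => /orP[/eqP ->|/Un//]; rewrite tn.
have sUn u : u \in take n s :: U -> (size u <= n.+1)%N.
  by rewrite inE => /orP[/eqP ->|/Un//]; rewrite size_take sn ltnSn.
rewrite (weight_cons_par _ sn tUn) ?inE ?negb_or ?st//.
rewrite weight_swap (weight_cons_par _ tn sUn); last first.
  rewrite inE negb_or tU andbT; apply/eqP => /(congr1 size).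
  by rewrite size_take sn ltnSn tn => /esym/n_Sn.
by rewrite weight_swap mulrA -expr2.
Qed.

Lemma momentS c x n U : splits_off c x ->
  (forall u, u \in U -> (size u <= n)%N) ->
  moment c n.+1 U =
  x * kernel_sum c n.+1 (fun s t => weight p (take n s :: take n t :: U)).
Proof.
move=> cx Un; rewrite -kernel_sumZ; apply: eq_kernel_sum => s t sn tn cst.
have nU u : u \in words n.+1 -> u \notin U.
  by rewrite mem_words => /eqP un; apply/negP => /Un; rewrite un ltnn.
by apply: cx => //; [move=> u /Un/leqW|exact: nU|exact: nU].
Qed.

Lemma moment_same_cubeS n U : (forall u, u \in U -> (size u <= n)%N) ->
  moment same_cube n.+1 U = (M%:R ^+ d * p) * moment same_cube n U.
Proof.
move=> Un; rewrite (momentS splits_off_same_cube)//.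
rewrite (kernel_sum_same_cubeS n (fun s t => weight p (s :: t :: U))).
by rewrite mulrA [p * _]mulrC.
Qed.

Lemma moment_adjacent_cubesS n U : (forall u, u \in U -> (size u <= n)%N) ->
  moment adjacent_cubes n.+1 U = (M%:R ^+ d.-1 * p ^+ 2) *
    (d%:R * (M%:R - 1) * moment same_cube n U + moment adjacent_cubes n U).
Proof.
move=> Un; rewrite (momentS splits_off_adjacent_cubes)//.
rewrite (kernel_sum_adjacent_cubesS M_gt0 n (fun s t => weight p (s :: t :: U))).
by rewrite mulrA [p ^+ 2 * _]mulrC.
Qed.

Lemma size_words_pair n s t : s \in words n -> t \in words n ->
  forall u : seq letter, u \in [:: s; t] -> (size u <= n)%N.
Proof.
by rewrite !mem_words => /eqP sn /eqP tn u; rewrite !inE =>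
  /orP[/eqP ->|/eqP ->]; rewrite ?sn ?tn.
Qed.

(** Exact, because only the deeper level advances: the words of the other kernel have length
    [n <= k] and carry no label of level [k.+1]. *)
Lemma moment2_same_cubeS c n k : (n <= k)%N ->
  moment2 c n same_cube k.+1 = (M%:R ^+ d * p) * moment2 c n same_cube k.
Proof.
move=> nk; rewrite /moment2 -kernel_sumZ; apply: eq_kernel_sum => s t sn tn _.
by apply: moment_same_cubeS => u /(size_words_pair sn tn) /leq_trans; apply.
Qed.

Lemma moment2_adjacent_cubesS c n k : (n <= k)%N ->
  moment2 c n adjacent_cubes k.+1 = (M%:R ^+ d.-1 * p ^+ 2) *
   (d%:R * (M%:R - 1) * moment2 c n same_cube k + moment2 c n adjacent_cubes k).
Proof.
move=> nk; rewrite /moment2 -kernel_sumZ -kernel_sumD -kernel_sumZ.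
apply: eq_kernel_sum => s t sn tn _.
by apply: moment_adjacent_cubesS => u /(size_words_pair sn tn) /leq_trans; apply.
Qed.

Lemma moment2C c n c' k : moment2 c n c' k = moment2 c' k c n.
Proof.
rewrite /moment2 /moment /kernel_sum.
transitivity (\sum_(s <- words n) \sum_(t <- words n) \sum_(u <- words k)
    \sum_(v <- words k) c s t * (c' u v * weight p [:: u; v; s; t])).
  apply: eq_bigr => s _; apply: eq_bigr => t _; rewrite mulr_sumr.
  by apply: eq_bigr => u _; rewrite mulr_sumr.
transitivity (\sum_(u <- words k) \sum_(v <- words k) \sum_(s <- words n)
    \sum_(t <- words n) c s t * (c' u v * weight p [:: u; v; s; t])); last first.
  apply: eq_bigr => u _; apply: eq_bigr => v _; rewrite mulr_sumr.
  apply: eq_bigr => s _; rewrite mulr_sumr; apply: eq_bigr => t _.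
  rewrite mulrCA; congr (_ * (_ * _)); apply: weight_eq_mem => w.
  by rewrite !inE; do 4![case: (w == _)].
under eq_bigr do rewrite exchange_big; rewrite exchange_big /=.
apply: eq_bigr => u _; under eq_bigr do rewrite exchange_big.
by rewrite exchange_big.
Qed.

End moments.

(** * Second moments when both levels advance *)

Section second_moments.
Context {R : realType} {d M : nat}.
Hypothesis M_gt0 : (0 < M)%N.
Hypothesis d_gt0 : (0 < d)%N.
Variable p : R.
Hypothesis p01 : 0 <= p <= 1.
Local Notation letter := 'I_(M ^ d).
Local Notation kernel := (seq letter -> seq letter -> R).
Local Notation same_cube := (@same_cube R d M).
Local Notation adjacent_cubes := (@adjacent_cubes R d M).
Local Notation moment2 := (moment2 p).

Lemma kernel_sum_norm_le (c : kernel) n F G :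
  (forall s t, 0 <= c s t) ->
  {in words n &, forall s t, c s t != 0 -> `|F s t| <= G s t} ->
  `|kernel_sum c n F| <= kernel_sum c n G.
Proof.
move=> c0 FG; apply: le_trans (ler_norm_sum _ _ _) _.
rewrite /kernel_sum 2!big_seq; apply: ler_sum => s sn.
apply: le_trans (ler_norm_sum _ _ _) _.
rewrite 2!big_seq; apply: ler_sum => t tn; rewrite normrM (ger0_norm (c0 _ _)).
by have [->|cst] := eqVneq (c s t) 0; rewrite ?mul0r// ler_wpM2l// FG.
Qed.

(** The summand is at least 1 whenever [s] or [t] is one of [u], [v], so this bounds the total
    weight of the pairs meeting [(u, v)], by four row or column sums. *)
Lemma kernel_sum_meet_le (D : R) (c : kernel) n u v : bounded_kernel D c ->
  u \in words n -> v \in words n ->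
  kernel_sum c n (fun s t => (s == u)%:R + (t == u)%:R +
    ((s == v)%:R + (t == v)%:R)) <= 4 * D.
Proof.
move=> cD un vn; rewrite !kernel_sumD.
have fstE w : w \in words n ->
    kernel_sum c n (fun s _ => (s == w)%:R) = \sum_(t <- words n) c w t.
  move=> wn; rewrite /kernel_sum exchange_big; apply: eq_bigr => t _.
  rewrite (bigD1_seq w) ?uniq_words//= eqxx mulr1 big1 ?addr0// => s /negbTE ->.
  by rewrite mulr0.
have sndE w : w \in words n ->
    kernel_sum c n (fun _ t => (t == w)%:R) = \sum_(s <- words n) c s w.
  move=> wn; rewrite /kernel_sum; apply: eq_bigr => s _.
  rewrite (bigD1_seq w) ?uniq_words//= eqxx mulr1 big1 ?addr0// => t /negbTE ->.
  by rewrite mulr0.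
rewrite !fstE// !sndE//.
by have [h1 h2] := cD n u un; have [h3 h4] := cD n v vn; lra.
Qed.

(* The weight factors exactly unless the pairs [(s, t)] and [(u, v)] share a word;
   there are [O (M ^ (d n))] such quadruples, each of weight at most [p ^ n]. *)
Lemma moment2_error (D x : R) (c c' : kernel) n :
  splits_off p c x -> 0 <= x <= 1 -> 0 <= D ->
  (forall s t, 0 <= c s t) -> (forall s t, 0 <= c' s t) ->
  bounded_kernel D c -> bounded_kernel D c' ->
  `|moment2 c' n.+1 c n.+1 - x * kernel_sum c' n.+1 (fun u v =>
      kernel_sum c n.+1 (fun s t => weight p [:: take n s; take n t; u; v]))| <=
  4 * D ^+ 2 * M%:R ^+ d * (M%:R ^+ d * p) ^+ n.
Proof.
move=> cx x01 D0 c0 c'0 cD c'D; have /andP[p0 p1] := p01; have /andP[x0 x1] := x01.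
have wle (s : seq letter) L : s \in words n.+1 -> weight p (take n s :: L) <= p ^+ n.
  rewrite mem_words => /eqP sn; have <- : size (take n s) = n.
    by rewrite size_take sn ltnSn.
  rewrite -weight1; apply: (weight_sub p01) => u; rewrite !inE.
  by rewrite size_take sn ltnSn => ->.
have wle' (s : seq letter) L : s \in words n.+1 -> weight p (s :: L) <= p ^+ n.
  rewrite mem_words => /eqP sn; apply: (@le_trans _ _ (p ^+ size s)); last first.
    by rewrite sn ler_wiXn2l// leqnSn.
  rewrite -weight1; apply: (weight_sub p01) => u; rewrite !inE.
  by move=> ->.
have pn0 : 0 <= p ^+ n by exact: exprn_ge0.
have key u v : u \in words n.+1 -> v \in words n.+1 ->
    `|moment p c n.+1 [:: u; v] - x * kernel_sum c n.+1 (fun s t =>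
        weight p [:: take n s; take n t; u; v])| <= p ^+ n * (4 * D).
  move=> un vn; rewrite -kernel_sumZ -kernel_sumB.
  apply: le_trans (ler_wpM2l pn0 (kernel_sum_meet_le cD un vn)).
  rewrite -kernel_sumZ; apply: kernel_sum_norm_le => // s t sn tn cst.
  have w1 := weight_ge0 p01 [:: s; t; u; v].
  have w2 := weight_ge0 p01 [:: take n s; take n t; u; v].
  have w3 := wle' s [:: t; u; v] sn.
  have w4 := wle s [:: take n t; u; v] sn.
  have b0 (b : bool) : 0 <= b%:R :> R by exact: ler0n.
  have xw : 0 <= x * weight p [:: take n s; take n t; u; v] <= p ^+ n.
    by rewrite mulr_ge0//= (le_trans _ w4)// ler_piMl.
  (* If the pairs meet, both terms lie in [[0, p ^ n]] and the summand is at least 1; otherwise the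
     factorization is exact and the difference vanishes. *)
  have [meet|] := boolP ((s \in [:: u; v]) || (t \in [:: u; v])).
    have : 1 <= (s == u)%:R + (t == u)%:R + ((s == v)%:R + (t == v)%:R) :> R.
      have := b0 (s == u); have := b0 (s == v); have := b0 (t == u);
      have := b0 (t == v); move: meet; rewrite !inE.
      by move=> /orP[/orP[]|/orP[]] -> /= *; lra.
    move=> /(ler_wpM2l pn0); rewrite mulr1; apply: le_trans.
    by case/andP: xw => xw1 xw2; rewrite ler_norml; apply/andP; split; lra.
  rewrite negb_or => /andP[su tu]; rewrite (cx _ _ _ _ sn tn cst)//; last first.
    exact: size_words_pair un vn.
  by rewrite subrr normr0 mulr_ge0// !addr_ge0.
rewrite -kernel_sumZ -kernel_sumB.
apply: le_trans (kernel_sum_norm_le c'0 _) _ => [u v un vn _|]; first exact: key.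
rewrite (_ : (fun _ _ => _) = (fun _ _ => p ^+ n * (4 * D) * 1)) ?kernel_sumZ; last first.
  by apply/funext => u; apply/funext => v; rewrite mulr1.
(* There are [M^(d(n+1))] choices of the first word, with row sum at most [D]; this gives the factor
   [M^d] and the second factor [D]. *)
have : kernel_sum c' n.+1 (fun _ _ => 1) <= (M%:R ^+ d) ^+ n.+1 * D.
  have -> : (M%:R ^+ d) ^+ n.+1 * D = \sum_(s <- @words d M n.+1) D.
    by rewrite big_const_seq count_predT size_words iter_addr_0 -!natrX mulr_natl.
  rewrite /kernel_sum 2!big_seq; apply: ler_sum => s sn.
  by under eq_bigr do rewrite mulr1; case: (c'D _ _ sn).
move=> h; apply: le_trans (ler_wpM2l _ h) _; first by rewrite !mulr_ge0.
by rewrite le_eqVlt; apply/orP; left; apply/eqP; rewrite exprMn exprS; ring.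
Qed.

End second_moments.

Section second_moment_recursions.
Context {R : realType} {d M : nat}.
Hypothesis M_gt0 : (0 < M)%N.
Hypothesis d_gt0 : (0 < d)%N.
Variable p : R.
Hypothesis p01 : 0 <= p <= 1.
Local Notation same_cube := (@same_cube R d M).
Local Notation adjacent_cubes := (@adjacent_cubes R d M).
Local Notation moment2 := (moment2 p).
Local Notation m := (M%:R ^+ d * p).
Local Notation c := (M%:R ^+ d.-1 * p ^+ 2).
Local Notation D := (d%:R * (M%:R - 1)).
Local Notation C := (4 * d%:R ^+ 2 * M%:R ^+ d : R).

Lemma moment2_error_same_cube c' n :
  (forall s t, 0 <= c' s t) -> bounded_kernel d%:R c' ->
  `|moment2 c' n.+1 same_cube n.+1 - m * moment2 c' n.+1 same_cube n| <= C * m ^+ n.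
Proof.
move=> c'0 c'D.
have := moment2_error p01 n (splits_off_same_cube p) p01 (ler0n _ d) same_cube_ge0
  c'0 (bounded_same_cube d_gt0) c'D.
rewrite (_ : p * _ = m * moment2 c' n.+1 same_cube n)//.
rewrite [m]mulrC -mulrA; congr (_ * _); rewrite /moment2 -kernel_sumZ.
apply: eq_kernel_sum => u v _ _ _.
exact: (kernel_sum_same_cubeS n (fun s t => weight p [:: s; t; u; v])).
Qed.

Lemma moment2_error_adjacent_cubes c' n :
  (forall s t, 0 <= c' s t) -> bounded_kernel d%:R c' ->
  `|moment2 c' n.+1 adjacent_cubes n.+1 - c * (D * moment2 c' n.+1 same_cube n +
      moment2 c' n.+1 adjacent_cubes n)| <= C * m ^+ n.
Proof.
move=> c'0 c'D; have p201 : 0 <= p ^+ 2 <= 1.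
  by case/andP: p01 => p0 p1; rewrite exprn_ge0//= exprn_ile1.
have := moment2_error p01 n (splits_off_adjacent_cubes p) p201 (ler0n _ d)
  adjacent_cubes_ge0 c'0 (bounded_adjacent_cubes M_gt0) c'D.
rewrite (_ : p ^+ 2 * _ = c * (D * moment2 c' n.+1 same_cube n +
  moment2 c' n.+1 adjacent_cubes n))//.
transitivity (p ^+ 2 * (M%:R ^+ d.-1 * (D * moment2 c' n.+1 same_cube n +
  moment2 c' n.+1 adjacent_cubes n))); last by ring.
congr (_ * _); rewrite /moment2 -kernel_sumZ -kernel_sumD -kernel_sumZ.
apply: eq_kernel_sum => u v _ _ _.
exact: (kernel_sum_adjacent_cubesS M_gt0 n (fun s t => weight p [:: s; t; u; v])).
Qed.

(** One argument is lowered from [n.+1] to [n] with an error, the other exactly, since the levels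
    [n.+1] and [n] already differ. The next two lemmas proceed likewise. *)
Lemma moment2_same_sameS n :
  `|moment2 same_cube n.+1 same_cube n.+1 - m ^+ 2 * moment2 same_cube n same_cube n|
  <= C * m ^+ n.
Proof.
have := moment2_error_same_cube n same_cube_ge0 (bounded_same_cube d_gt0).
by rewrite (moment2C _ _ n.+1 _ n) (moment2_same_cubeS _ _ (leqnn n)) mulrA -expr2.
Qed.

Lemma moment2_same_adjacentS n :
  `|moment2 same_cube n.+1 adjacent_cubes n.+1 - m * c *
     (D * moment2 same_cube n same_cube n + moment2 same_cube n adjacent_cubes n)|
  <= C * m ^+ n.
Proof.
have := moment2_error_adjacent_cubes n same_cube_ge0 (bounded_same_cube d_gt0).
rewrite !(moment2C _ _ n.+1 _ n) !(moment2_same_cubeS _ _ (leqnn n)).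
rewrite (moment2C _ adjacent_cubes) (_ : c * _ = m * c * (D *
  moment2 same_cube n same_cube n + moment2 same_cube n adjacent_cubes n))//.
by ring.
Qed.

Lemma moment2_adjacent_adjacentS n :
  `|moment2 adjacent_cubes n.+1 adjacent_cubes n.+1 - c ^+ 2 *
     (D ^+ 2 * moment2 same_cube n same_cube n +
      2 * D * moment2 same_cube n adjacent_cubes n +
      moment2 adjacent_cubes n adjacent_cubes n)|
  <= C * m ^+ n.
Proof.
have := moment2_error_adjacent_cubes n adjacent_cubes_ge0 (bounded_adjacent_cubes M_gt0).
rewrite !(moment2C _ _ n.+1 _ n) !(moment2_adjacent_cubesS M_gt0 _ _ (leqnn n)).
rewrite (moment2C _ adjacent_cubes n same_cube) (_ : c * _ = c ^+ 2 *
     (D ^+ 2 * moment2 same_cube n same_cube n +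
      2 * D * moment2 same_cube n adjacent_cubes n +
      moment2 adjacent_cubes n adjacent_cubes n))//.
by ring.
Qed.

End second_moment_recursions.

(** * The two-type recursion *)

Section two_type_recursion.
Context {R : realType} (a b : R).
Hypothesis ab01 : [/\ 0 < a, a < 1, 0 < b & b < 1].

Fixpoint rate (n : nat) : R :=
  if n is k.+1 then a * rate k + b ^+ k.+1 else 1.

Lemma rate_ge n : a ^+ n <= rate n /\ b ^+ n <= rate n.
Proof.
have [a0 a1 b0 b1] := ab01; elim: n => [|n [IHa IHb]] /=; first by rewrite !expr0.
have an : 0 <= a ^+ n by rewrite exprn_ge0// ltW.
have bn : 0 <= b ^+ n by rewrite exprn_ge0// ltW.
rewrite !exprS; split; first by nra.
by rewrite lerDr mulr_ge0 ?(le_trans bn IHb)// ltW.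
Qed.

Lemma rate_ge0 n : 0 <= rate n.
Proof.
by have [a0 _ _ _] := ab01; apply: le_trans (rate_ge n).1; rewrite exprn_ge0// ltW.
Qed.

Lemma rateD n j : rate (n + j) = a ^+ j * rate n + b ^+ n * (rate j - a ^+ j).
Proof.
elim: j => [|j IH]; first by rewrite addn0 expr0 /= subrr mulr0 addr0 mul1r.
by rewrite addnS /= IH -addnS exprD !exprS; ring.
Qed.

(** Submultiplicativity up to a constant: with [sum_rate_le] it bounds the tail [sum_j rate (n + j)]
    by a multiple of [rate n], without separating the case [a = b]. *)
Lemma rateD_le n j : rate (n + j) <= 2 * rate n * rate j.
Proof.
have [a0 a1 b0 b1] := ab01.
rewrite rateD; have [an bn] := rate_ge n; have [aj bj] := rate_ge j.
have rn := rate_ge0 n; have rj := rate_ge0 j.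
have aj0 : 0 <= a ^+ j by rewrite exprn_ge0// ltW.
have bn0 : 0 <= b ^+ n by rewrite exprn_ge0// ltW.
have h1 := ler_wpM2r rn aj; have h2 := ler_wpM2r rj bn.
have h3 := mulr_ge0 bn0 aj0; lra.
Qed.

(** [rate] is the Cauchy product of two geometric sequences, and the bound is the product of their
    sums. *)
Lemma sum_rate_le n : \sum_(j < n) rate j <= ((1 - a) * (1 - b))^-1.
Proof.
have [a0 a1 b0 b1] := ab01.
have geoE k : \sum_(j < k) b ^+ j <= (1 - b)^-1.
  have : (1 - b) * \sum_(j < k) b ^+ j = 1 - b ^+ k.
    by rewrite -[1 - b]opprB mulNr -subrX1 opprB.
  move=> e; rewrite -[X in _ <= X]mul1r ler_pdivlMr ?subr_gt0// mulrC e.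
  by rewrite lerBlDr lerDl exprn_ge0// ltW.
have SE k : \sum_(j < k.+1) rate j = a * (\sum_(j < k) rate j) + \sum_(j < k.+1) b ^+ j.
  elim: k => [|k IH]; first by rewrite !big_ord1 big_ord0 mulr0 add0r.
  have e : \sum_(j < k.+1) rate j = \sum_(j < k) rate j + rate k.
    by rewrite big_ord_recr.
  by rewrite !(big_ord_recr k.+1) /= {1}IH e; ring.
elim: n => [|n IH].
  by rewrite big_ord0 invr_ge0 mulr_ge0// subr_ge0 ltW.
rewrite SE; apply: (@le_trans _ _ (a * ((1 - a) * (1 - b))^-1 + (1 - b)^-1)).
  by rewrite lerD// ler_wpM2l// ltW.
rewrite le_eqVlt; apply/orP; left; apply/eqP; field.
by rewrite !subr_eq0 !gt_eqF.
Qed.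

Lemma rateS_le n : rate n.+1 <= 2 * rate n.
Proof.
have [a0 a1 b0 b1] := ab01; have [_ bn] := rate_ge n; have rn := rate_ge0 n.
have bn0 : 0 <= b ^+ n by rewrite exprn_ge0// ltW.
by rewrite /= exprS; nra.
Qed.

(** For [a != b] this makes [rate n] of the order of the larger of the two powers; [rate_eq]
    supplies the extra factor [n.+1] of the remaining case. *)
Lemma rate_diff n : (a - b) * rate n = a ^+ n.+1 - b ^+ n.+1.
Proof.
elim: n => [|n IH]; first by rewrite /= mulr1 !expr1.
by rewrite /= mulrDr mulrCA IH !exprS; ring.
Qed.

Lemma rate_eq n : a = b -> rate n = n.+1%:R * a ^+ n.
Proof.
move=> ab; elim: n => [|n IH]; first by rewrite /= expr0 mul1r.
by rewrite /= IH -ab -[n.+2%:R]natr1 exprS; ring.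
Qed.

Lemma rate_bound (x : nat -> R) (e k : R) : 0 <= k <= a ->
  (forall n, `|x n.+1 - k * x n| <= e * b ^+ n) ->
  exists2 C, 0 <= C & forall n, `|x n| <= C * rate n.
Proof.
have [a0 a1 b0 b1] := ab01; move=> /andP[k0 ka] xS.
have e0 : 0 <= e by have := xS 0%N; rewrite expr0 mulr1; apply: le_trans.
(* The error [e * b ^ n] equals [e / b] times [b ^ n.+1], the term that [rate n.+1] adds to
   [a * rate n]. *)
exists (`|x 0%N| + e / b).
  by rewrite addr_ge0// divr_ge0// ltW.
elim=> [|n IH] /=; first by rewrite mulr1 lerDl divr_ge0// ltW.
have -> : x n.+1 = (x n.+1 - k * x n) + k * x n by rewrite subrK.
apply: le_trans (ler_normD _ _) _; rewrite normrM (ger0_norm k0) mulrDr addrC.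
apply: lerD.
  rewrite mulrCA; apply: (@le_trans _ _ (a * `|x n|)).
    by rewrite ler_wpM2r.
  by rewrite ler_wpM2l// ltW.
apply: le_trans (xS n) _.
have -> : (`|x 0%N| + e / b) * b ^+ n.+1 = `|x 0%N| * b ^+ n.+1 + e * b ^+ n.
  by rewrite exprS; field; rewrite gt_eqF.
by rewrite lerDr !mulr_ge0// ?exprn_ge0// ltW.
Qed.

End two_type_recursion.

(** * Normalized moments and the Cauchy estimate *)

Section normalized_moments.
Context {R : realType} {d M : nat}.
Hypothesis M_gt1 : (1 < M)%N.
Hypothesis d_gt0 : (0 < d)%N.
Variable p : R.
Hypothesis p_gt : M%:R ^- d < p.
Hypothesis p_le1 : p <= 1.
Local Notation same_cube := (@same_cube R d M).
Local Notation adjacent_cubes := (@adjacent_cubes R d M).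
Local Notation kernel := (seq 'I_(M ^ d) -> seq 'I_(M ^ d) -> R).
Local Notation moment2 := (moment2 p).
Local Notation m := (M%:R ^+ d * p).
Local Notation c := (M%:R ^+ d.-1 * p ^+ 2).
Local Notation D := (d%:R * (M%:R - 1)).
Local Notation a := (p / M%:R).
Local Notation b := (M%:R ^+ d * p)^-1.

Let kappa : R := d%:R * p * (M%:R - 1) / (M%:R - p).

Let M_gt0 : (0 < M)%N. Proof. exact: ltnW. Qed.

Let M_gt0R : 0 < M%:R :> R. Proof. by rewrite ltr0n. Qed.

Let M_gt1R : 1 < M%:R :> R. Proof. by rewrite ltr1n. Qed.

Let p_gt0 : 0 < p.
Proof. by apply: lt_trans p_gt; rewrite invr_gt0 exprn_gt0. Qed.

Let p01 : 0 <= p <= 1. Proof. by rewrite ltW. Qed.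

Let m_gt1 : 1 < m.
Proof. by move: p_gt; rewrite -div1r ltr_pdivrMr ?exprn_gt0// mulrC. Qed.

Let m_gt0 : 0 < m. Proof. exact: lt_trans m_gt1. Qed.

Lemma percolation_rates : [/\ 0 < a, a < 1, 0 < b & b < 1].
Proof.
split; first by rewrite divr_gt0.
- by rewrite ltr_pdivrMr// mul1r (le_lt_trans p_le1).
- by rewrite invr_gt0.
- by rewrite invf_lt1.
Qed.

Let bc : b * c = a.
Proof.
rewrite -[in M%:R ^+ d](prednK d_gt0) exprS; field.
by rewrite !gt_eqF ?exprn_gt0.
Qed.

Let bm : b * m = 1. Proof. by rewrite mulVf ?gt_eqF. Qed.

(** [kappa] is the fixed point of [x -> a (D + x)], the step of the normalized mean of [A]. The
    cancellations below all go through this equation. *)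
Let kappaE : kappa * (1 - a) = a * D.
Proof.
rewrite /kappa; field; rewrite gt_eqF//= subr_eq0 gt_eqF//.
exact: le_lt_trans M_gt1R.
Qed.

Definition normalized_mean (c1 : kernel) n : R := b ^+ n * moment p c1 n [::].

Definition normalized_moment2 (c1 : kernel) n (c2 : kernel) k : R :=
  b ^+ n * b ^+ k * moment2 c1 n c2 k.

Lemma normalized_moment2C c1 n c2 k :
  normalized_moment2 c1 n c2 k = normalized_moment2 c2 k c1 n.
Proof. by rewrite /normalized_moment2 moment2C [b ^+ k * _]mulrC. Qed.

Lemma words0 : @words d M 0 = [:: [::]]. Proof. by []. Qed.

Lemma adjacent_cubes_nil : adjacent_cubes [::] [::] = 0.
Proof. by apply: big1 => l _; case: (boolP (precedes _ _ _)) => // /precedes_neq. Qed.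

Lemma moment_same_cube n : moment p same_cube n [::] = m ^+ n.
Proof.
elim: n => [|n IH]; last by rewrite moment_same_cubeS// IH exprS.
rewrite /moment kernel_sum_same_cube words0 big_seq1 !weight_cons_nil.
by rewrite weight_nil.
Qed.

Lemma moment_adjacent_cubes0 U : moment p adjacent_cubes 0 U = 0.
Proof.
by rewrite /moment /kernel_sum words0 !big_seq1 adjacent_cubes_nil mul0r.
Qed.

Lemma normalized_mean_same_cube n : normalized_mean same_cube n = 1.
Proof. by rewrite /normalized_mean moment_same_cube -exprMn bm expr1n. Qed.

Lemma normalized_mean_adjacent_cubes n :
  normalized_mean adjacent_cubes n = kappa * (1 - a ^+ n).
Proof.
elim: n => [|n IH].
  by rewrite /normalized_mean moment_adjacent_cubes0 !mulr0 expr0 subrr mulr0.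
have -> : normalized_mean adjacent_cubes n.+1 =
    b * c * (D * normalized_mean same_cube n + normalized_mean adjacent_cubes n).
  by rewrite /normalized_mean moment_adjacent_cubesS// exprS; ring.
rewrite normalized_mean_same_cube IH bc mulr1 mulrDr -kappaE exprS; ring.
Qed.

Local Notation WW n := (normalized_moment2 same_cube n same_cube n).
Local Notation WG n := (normalized_moment2 same_cube n adjacent_cubes n).
Local Notation GG n := (normalized_moment2 adjacent_cubes n adjacent_cubes n).
Local Notation C0 := (4 * d%:R ^+ 2 * M%:R ^+ d : R).

(** Normalization turns [m ^ n] into [b ^ (n + 2)], which is weakened to [b ^ n]. *)
Lemma normalize_error n (x y : R) : `|x - y| <= C0 * m ^+ n ->
  `|b ^+ n.+1 * b ^+ n.+1 * x - b ^+ n.+1 * b ^+ n.+1 * y| <= C0 * b ^+ n.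
Proof.
have [_ _ b0 b1] := percolation_rates.
have bb0 : 0 <= b ^+ n.+1 * b ^+ n.+1 by rewrite mulr_ge0 ?exprn_ge0 ?ltW.
rewrite -mulrBr normrM (ger0_norm bb0) => /(ler_wpM2l bb0) /le_trans; apply.
have -> : b ^+ n.+1 * b ^+ n.+1 * (C0 * m ^+ n) = C0 * (b ^+ 2 * b ^+ n).
  transitivity (C0 * (b ^+ 2 * b ^+ n) * (b * m) ^+ n).
    by rewrite (exprMn n b m) !exprS; ring.
  by rewrite bm expr1n mulr1.
apply: ler_wpM2l; first by rewrite !mulr_ge0 ?exprn_ge0.
by rewrite ler_piMl// ?exprn_ge0 ?exprn_ile1// ltW.
Qed.

Lemma WWS n : `|WW n.+1 - WW n| <= C0 * b ^+ n.
Proof.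
have := normalize_error (moment2_same_sameS d_gt0 p01 n).
rewrite (_ : _ * (m ^+ 2 * _) = WW n)//.
transitivity ((b * m) ^+ 2 * WW n); last by rewrite bm expr1n mul1r.
rewrite /normalized_moment2 !exprS; set bb := b; set mm := m. ring.
Qed.

Lemma WGS n : `|WG n.+1 - a * (D * WW n + WG n)| <= C0 * b ^+ n.
Proof.
have := normalize_error (moment2_same_adjacentS M_gt0 d_gt0 p01 n).
rewrite (_ : _ * (m * c * _) = a * (D * WW n + WG n))//.
rewrite -bc; transitivity (b * m * (b * c * (D * WW n + WG n))).
  by rewrite /normalized_moment2 !exprS; set bb := b; set mm := m; ring.
by rewrite bm mul1r.
Qed.

Lemma GGS n : `|GG n.+1 - a ^+ 2 * (D ^+ 2 * WW n + 2 * D * WG n + GG n)|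
  <= C0 * b ^+ n.
Proof.
have := normalize_error (moment2_adjacent_adjacentS M_gt0 p01 n).
rewrite (_ : _ * (c ^+ 2 * _) =
  a ^+ 2 * (D ^+ 2 * WW n + 2 * D * WG n + GG n))//.
by rewrite /normalized_moment2 -bc exprMn !exprS; ring.
Qed.

(* [kappa * N - A] is the eigenvector with eigenvalue [a] of the normalized
   mean recursion of (N, A); it is what makes [Z_n] differ from a martingale. *)
Let WH n : R := kappa * WW n - WG n.
Let HH n : R := kappa ^+ 2 * WW n - 2 * kappa * WG n + GG n.

Let kappa_ge0 : 0 <= kappa.
Proof.
rewrite /kappa divr_ge0 ?mulr_ge0 ?subr_ge0 ?(ltW p_gt0) ?(ltW M_gt1R)//.
exact: le_trans p_le1 (ltW _).
Qed.

Lemma WH_bound : exists2 C, 0 <= C & forall n, `|WH n| <= C * rate a b n.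
Proof.
have [a0 a1 b0 b1] := percolation_rates.
apply: (@rate_bound _ _ _ percolation_rates WH (kappa * C0 + C0) a).
  by rewrite (ltW a0) lexx.
move=> n.
(* Apart from the errors of the two recursions, only a multiple of [kappa * (1 - a) - a * D] is
   left, which is 0. *)
have -> : WH n.+1 - a * WH n = kappa * (WW n.+1 - WW n) -
    (WG n.+1 - a * (D * WW n + WG n)) + (kappa * (1 - a) - a * D) * WW n.
  by rewrite /WH; ring.
rewrite kappaE subrr mul0r addr0; apply: le_trans (ler_normB _ _) _.
rewrite normrM (ger0_norm kappa_ge0).
have -> : (kappa * C0 + C0) * b ^+ n = kappa * (C0 * b ^+ n) + C0 * b ^+ n.
  by ring.
by apply: lerD; [rewrite ler_wpM2l// WWS|exact: WGS].
Qed.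

(** The multiplier is now [a ^ 2], which is at most [a], so the same [rate] serves. *)
Lemma HH_bound : exists2 C, 0 <= C & forall n, `|HH n| <= C * rate a b n.
Proof.
have [a0 a1 b0 b1] := percolation_rates.
apply: (@rate_bound _ _ _ percolation_rates HH
  (kappa ^+ 2 * C0 + 2 * kappa * C0 + C0) (a ^+ 2)).
  by rewrite expr2 mulr_ge0 ?ler_piMr // ltW.
move=> n.
have -> : HH n.+1 - a ^+ 2 * HH n = kappa ^+ 2 * (WW n.+1 - WW n) -
    2 * kappa * (WG n.+1 - a * (D * WW n + WG n)) +
    (GG n.+1 - a ^+ 2 * (D ^+ 2 * WW n + 2 * D * WG n + GG n)) +
    ((kappa - a * D + a * kappa) * WW n - 2 * a * WG n) *
      (kappa * (1 - a) - a * D).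
  by rewrite /HH; ring.
rewrite kappaE subrr mulr0 addr0; apply: le_trans (ler_normD _ _) _.
rewrite [X in _ <= X](_ : _ =
  (kappa ^+ 2 * C0 + 2 * kappa * C0) * b ^+ n + C0 * b ^+ n); last by ring.
apply: lerD; last exact: GGS.
apply: le_trans (ler_normB _ _) _.
have -> : (kappa ^+ 2 * C0 + 2 * kappa * C0) * b ^+ n =
    kappa ^+ 2 * (C0 * b ^+ n) + 2 * (kappa * (C0 * b ^+ n)) by ring.
apply: lerD.
  by rewrite normrM ger0_norm ?exprn_ge0// ler_wpM2l ?exprn_ge0// WWS.
rewrite -mulrA normrM ger0_norm// ler_wpM2l// normrM ger0_norm// ler_wpM2l//.
exact: WGS.
Qed.

Definition surface_mean n : R :=
  d%:R * normalized_mean same_cube n - normalized_mean adjacent_cubes n.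

(** The expectation of [Z_n Z_k], expanded bilinearly from [Z = d W - G], with [W] and [G] the
    normalized counts of cubes and of adjacent pairs. *)
Definition surface_moment2 n k : R :=
  d%:R ^+ 2 * normalized_moment2 same_cube n same_cube k -
  d%:R * normalized_moment2 same_cube n adjacent_cubes k -
  d%:R * normalized_moment2 adjacent_cubes n same_cube k +
  normalized_moment2 adjacent_cubes n adjacent_cubes k.

Lemma surface_meanE n : surface_mean n = d%:R - kappa + kappa * a ^+ n.
Proof.
rewrite /surface_mean normalized_mean_same_cube normalized_mean_adjacent_cubes.
ring.
Qed.

(** The expectations of [Z_n W_k] and (for [ZG]) of [Z_n G_k]. For fixed [n] and [k >= n] they obey
    the exact recursions. *)
Let ZW n k : R := d%:R * normalized_moment2 same_cube n same_cube k -
  normalized_moment2 adjacent_cubes n same_cube k.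
Let ZG n k : R := d%:R * normalized_moment2 same_cube n adjacent_cubes k -
  normalized_moment2 adjacent_cubes n adjacent_cubes k.

Lemma ZW_const n k : ZW n (n + k) = ZW n n.
Proof.
elim: k => [|k <-]; first by rewrite addn0.
rewrite addnS /ZW /normalized_moment2 !moment2_same_cubeS ?leq_addr//.
transitivity (b * m * ZW n (n + k)); last by rewrite bm mul1r.
by rewrite /ZW /normalized_moment2 !exprS; ring.
Qed.

Lemma ZH_geometric n k : kappa * ZW n n - ZG n (n + k) =
  a ^+ k * (kappa * ZW n n - ZG n n).
Proof.
elim: k => [|k IH]; first by rewrite addn0 expr0 mul1r.
have GS : ZG n (n + k).+1 = a * (D * ZW n (n + k) + ZG n (n + k)).
  rewrite -bc /ZG /ZW /normalized_moment2 !moment2_adjacent_cubesS ?leq_addr//.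
  by rewrite !exprS; ring.
rewrite addnS GS ZW_const [RHS](_ : _ = a * (a ^+ k * (kappa * ZW n n - ZG n n))).
  rewrite -IH.
  transitivity (a * (kappa * ZW n n - ZG n (n + k)) +
    (kappa * (1 - a) - a * D) * ZW n n); first by ring.
  by rewrite kappaE subrr mul0r addr0.
by rewrite exprS mulrA.
Qed.

(** Write [Z = (d - kappa) W + H] with [H = kappa W - G]. Given level [n], the mean of [W_{n+k}] is
    [W_n] and that of [H_{n+k}] is [a^k H_n], so [Z_n - Z_{n+k}] averages to [(1 - a^k) H_n]. *)
Lemma surface_moment2_gap n k :
  surface_moment2 n n - surface_moment2 n (n + k) =
  (1 - a ^+ k) * ((d%:R - kappa) * WH n + HH n).
Proof.
have SE j : surface_moment2 n j = d%:R * ZW n j - ZG n j.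
  by rewrite /surface_moment2 /ZW /ZG; ring.
have -> : (d%:R - kappa) * WH n + HH n = kappa * ZW n n - ZG n n.
  by rewrite /WH /HH /ZW /ZG (normalized_moment2C adjacent_cubes n same_cube n); ring.
rewrite !SE ZW_const mulrBl mul1r -ZH_geometric; ring.
Qed.

Lemma surface_moment2_diag n : surface_moment2 n n =
  (d%:R - kappa) ^+ 2 * WW n + 2 * (d%:R - kappa) * WH n + HH n.
Proof.
by rewrite /surface_moment2 /WH /HH (normalized_moment2C adjacent_cubes n same_cube n); ring.
Qed.

(** The first bound telescopes the increments of the diagonal. The second is for the squared [L^2]
    distance, which is the increment of the diagonal plus twice the gap of [surface_moment2_gap]. *)
Lemma surface_moment2_cauchy : exists2 C, 0 <= C & forall n k,
  `|surface_moment2 (n + k) (n + k) - surface_moment2 n n| <= C * rate a b n /\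
  surface_moment2 (n + k) (n + k) - 2 * surface_moment2 n (n + k) +
    surface_moment2 n n <= C * rate a b n.
Proof.
have ab := percolation_rates; have [a0 a1 b0 b1] := ab.
have [C1 C10 h1] := WH_bound; have [C2 C20 h2] := HH_bound.
pose e := `|d%:R - kappa|; have e0 : 0 <= e by exact: normr_ge0.
(* By [rateS_le], a sequence bounded by [C * rate] has increments at most [3 * C * rate n]; the
   increments of [WW] are bounded directly by [C0 * b ^ n]. *)
pose C3 := e ^+ 2 * C0 + 3 * (2 * e * C1) + 3 * C2.
have C00 : 0 <= C0 by rewrite !mulr_ge0 ?exprn_ge0.
have C30 : 0 <= C3 by rewrite !addr_ge0 ?mulr_ge0 ?exprn_ge0.
have r0 n : 0 <= rate a b n := rate_ge0 ab n.
have step n : `|surface_moment2 n.+1 n.+1 - surface_moment2 n n| <= C3 * rate a b n.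
  rewrite !surface_moment2_diag.
  have rS := rateS_le ab n; have [_ rb] := rate_ge ab n.
  have -> : (d%:R - kappa) ^+ 2 * WW n.+1 + 2 * (d%:R - kappa) * WH n.+1 + HH n.+1 -
      ((d%:R - kappa) ^+ 2 * WW n + 2 * (d%:R - kappa) * WH n + HH n) =
      (d%:R - kappa) ^+ 2 * (WW n.+1 - WW n) +
      2 * (d%:R - kappa) * (WH n.+1 - WH n) + (HH n.+1 - HH n) by ring.
  apply: le_trans (ler_normD _ _) _.
  rewrite /C3 [X in _ <= X]mulrDl; apply: lerD; last first.
    apply: le_trans (ler_normB _ _) _.
    by have := ler_wpM2l C20 rS; have := h2 n; have := h2 n.+1; lra.
  apply: le_trans (ler_normD _ _) _; rewrite [X in _ <= X]mulrDl; apply: lerD.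
    rewrite normrM normrX -/e -mulrA ler_wpM2l ?exprn_ge0//.
    by apply: le_trans (WWS n) _; rewrite ler_wpM2l.
  have -> : 3 * (2 * e * C1) * rate a b n = (2 * e) * (3 * C1 * rate a b n) by ring.
  rewrite !normrM -/e (ger0_norm (ler0n _ 2)) ler_wpM2l ?mulr_ge0//.
  apply: le_trans (ler_normB _ _) _.
  by have := ler_wpM2l C10 rS; have := h1 n; have := h1 n.+1; lra.
pose S := ((1 - a) * (1 - b))^-1.
have S0 : 0 <= S by rewrite invr_ge0 mulr_ge0// subr_ge0 ltW.
have tele n k : `|surface_moment2 (n + k) (n + k) - surface_moment2 n n| <=
    C3 * (2 * S) * rate a b n.
  apply: (@le_trans _ _ (C3 * (2 * rate a b n * \sum_(j < k) rate a b j))); last first.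
    have -> : C3 * (2 * S) * rate a b n = C3 * (2 * rate a b n * S) by ring.
    by rewrite ler_wpM2l// ler_wpM2l ?mulr_ge0// sum_rate_le.
  elim: k => [|k IH]; first by rewrite addn0 subrr normr0 big_ord0 !mulr0.
  rewrite addnS big_ord_recr /=.
  have -> : surface_moment2 (n + k).+1 (n + k).+1 - surface_moment2 n n =
    (surface_moment2 (n + k).+1 (n + k).+1 - surface_moment2 (n + k) (n + k)) +
    (surface_moment2 (n + k) (n + k) - surface_moment2 n n) by ring.
  apply: le_trans (ler_normD _ _) _; rewrite 2!mulrDr addrC; apply: lerD => //.
  by apply: le_trans (step _) _; rewrite ler_wpM2l// rateD_le.
exists (C3 * (2 * S) + 2 * (e * C1 + C2)).
  by rewrite addr_ge0 ?mulr_ge0// addr_ge0 ?mulr_ge0.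
move=> n k; split.
  apply: le_trans (tele n k) _; rewrite ler_wpM2r// lerDl.
  by rewrite mulr_ge0// addr_ge0 ?mulr_ge0.
have -> : surface_moment2 (n + k) (n + k) - 2 * surface_moment2 n (n + k) +
    surface_moment2 n n = (surface_moment2 (n + k) (n + k) - surface_moment2 n n) +
    2 * (surface_moment2 n n - surface_moment2 n (n + k)) by ring.
rewrite [X in _ <= X]mulrDl; apply: lerD; first exact: le_trans (ler_norm _) (tele n k).
rewrite surface_moment2_gap -mulrA ler_wpM2l//.
apply: le_trans (ler_norm _) _; rewrite normrM.
have ak : 0 <= a ^+ k <= 1 by rewrite exprn_ge0 ?exprn_ile1 ?ltW.
have a1k : `|1 - a ^+ k| <= 1.
  by case/andP: ak => ak0 ak1; rewrite ler_norml; apply/andP; split; lra.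
apply: (@le_trans _ _ (1 * `|(d%:R - kappa) * WH n + HH n|)).
  by rewrite ler_wpM2r.
rewrite mul1r; apply: le_trans (ler_normD _ _) _.
rewrite [X in _ <= X]mulrDl; apply: lerD => //.
by rewrite normrM -/e -mulrA ler_wpM2l.
Qed.

End normalized_moments.

Arguments surface_mean {R} d M p n.
Arguments surface_moment2 {R} d M p n k.

(** * Square-integrable limits *)

Section square_integrable.
Context {dO : measure_display} {Omega : measurableType dO} {R : realType}.
Variable P : probability Omega R.
Implicit Types f g : Omega -> R.

Lemma measurable_Lfun f r : f \in Lfun P r -> measurable_fun setT f.
Proof. by rewrite inE => /andP[]; rewrite inE. Qed.

Lemma Lfun2B f g : f \in Lfun P 2%:E -> g \in Lfun P 2%:E ->
  (fun w => f w - g w) \in Lfun P 2%:E.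
Proof. by move=> f2 g2; apply: rpredB; rewrite ?lee1n// => _. Qed.

Lemma Lfun2D f g : f \in Lfun P 2%:E -> g \in Lfun P 2%:E ->
  (fun w => f w + g w) \in Lfun P 2%:E.
Proof. by move=> f2 g2; apply: rpredD; rewrite ?lee1n// => _. Qed.

Lemma Lfun2_of_sqr f : measurable_fun setT f ->
  (\int[P]_w (f w ^+ 2)%:E < +oo)%E -> f \in Lfun P 2%:E.
Proof.
move=> mf f2; rewrite inE; apply/andP; split; rewrite inE/=//.
rewrite /finite_norm unlock /=; apply: poweR_lty.
rewrite (eq_integral (fun w => (f w ^+ 2)%:E))// => w _ /=.
by rewrite powR_mulrn// -normrX ger0_norm// sqr_ge0.
Qed.

Lemma Lfun2_bounded f (C : R) : measurable_fun setT f ->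
  (forall w, `|f w| <= C) -> f \in Lfun P 2%:E.
Proof.
move=> mf fC; apply: Lfun2_of_sqr => //.
apply: (@le_lt_trans _ _ (\int[P]_w (cst (C ^+ 2)%:E w))%E); last first.
  by rewrite integral_cst//= probability_setT mule1 ltry.
apply: ge0_le_integral => //.
- by move=> w _; rewrite lee_fin sqr_ge0.
- by apply/measurable_EFinP; exact: measurable_funX.
move=> w _; rewrite lee_fin -[f w ^+ 2]ger0_norm ?sqr_ge0// normrX.
by rewrite lerXn2r ?nnegrE// (le_trans _ (fC w)).
Qed.

Local Notation Ex f := (\int[P]_w f w)%R.

Lemma integrable_Lfun1 f : f \in Lfun P 1 -> P.-integrable setT (EFin \o f).
Proof. by move/Lfun1_integrable. Qed.

Lemma Lfun21 f : f \in Lfun P 2%:E -> f \in Lfun P 1.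
Proof. by apply: Lfun_subset12; exact: fin_num_measure. Qed.

Lemma expectation_Rintegral f : f \in Lfun P 1 -> 'E_P[f]%E = (Ex f)%:E.
Proof.
move=> f1; rewrite unlock /Rintegral fineK//.
by apply: integrable_fin_num => //; exact: integrable_Lfun1.
Qed.

Lemma variance_Rintegral f : f \in Lfun P 2%:E ->
  'V_P[f]%E = (Ex (fun w => f w ^+ 2) - Ex f ^+ 2)%:E.
Proof.
move=> f2; rewrite varianceE// (expectation_Rintegral (Lfun21 f2)).
have ff : (fun w => f w ^+ 2) \in Lfun P 1 by exact: (Lfun2_mul_Lfun1 f2 f2).
by rewrite [X in 'E_P[X]%E](_ : _ = (fun w => f w ^+ 2)) ?expectation_Rintegral.
Qed.

(* AM-GM: [2 |f g| <= l f^2 + g^2 / l]. *)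
Lemma Rintegral_mul_le f g (l : R) : 0 < l ->
  f \in Lfun P 2%:E -> g \in Lfun P 2%:E ->
  2 * `|Ex (fun w => f w * g w)| <=
  l * Ex (fun w => f w ^+ 2) + l^-1 * Ex (fun w => g w ^+ 2).
Proof.
move=> l0 f2 g2.
have ff := integrable_Lfun1 (Lfun2_mul_Lfun1 f2 f2).
have gg := integrable_Lfun1 (Lfun2_mul_Lfun1 g2 g2).
have fg := integrable_Lfun1 (Lfun2_mul_Lfun1 f2 g2).
have li : l * l^-1 = 1 by rewrite divff// gt_eqF.
(* [e] is a sign; [1] and [-1] together give the absolute value. *)
have key (e : R) : e ^+ 2 = 1 -> e * 2 * Ex (fun w => f w * g w) <=
    l * Ex (fun w => f w ^+ 2) + l^-1 * Ex (fun w => g w ^+ 2).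
  move=> e1; rewrite -!RintegralZl// -RintegralD//; last 2 first.
  - exact: (integrableZl _ _ ff).
  - exact: (integrableZl _ _ gg).
  apply: le_Rintegral => //.
  - exact: (integrableZl _ _ fg).
  - apply: (integrableD _ (integrableZl _ _ ff) (integrableZl _ _ gg)) => //.
  move=> w _; rewrite -subr_ge0.
  have -> : l * f w ^+ 2 + l^-1 * g w ^+ 2 - e * 2 * (f w * g w) =
      l * (f w - e * l^-1 * g w) ^+ 2.
    transitivity (l * f w ^+ 2 - (l * l^-1) * (2 * e * (f w * g w)) +
      (l * l^-1) * l^-1 * (e ^+ 2 * g w ^+ 2)); last by ring.
    by rewrite li e1; ring.
  by rewrite mulr_ge0 ?sqr_ge0 ?ltW.
have h1 := key 1 (expr1n _ _); have h2 := key (-1) (etrans (sqrrN 1) (expr1n _ _)).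
have [_|_] := ger0P (Ex (fun w => f w * g w)); first by move: h1; lra.
by move: h2; lra.
Qed.

(** * Convergence of first and second moments to those of the limit *)

Section square_integrable_limit.
Variables (X : nat -> Omega -> R) (Y : Omega -> R) (r : nat -> R).
Hypothesis X2 : forall n, X n \in Lfun P 2%:E.
Hypothesis mY : measurable_fun setT Y.
Hypothesis XY : {ae P, forall w, X n w @[n --> \oo] --> Y w}.
Hypothesis Xr : forall n k, Ex (fun w => (X (n + k) w - X n w) ^+ 2) <= r n.
Hypothesis r0 : r n @[n --> \oo] --> 0.

Let mX n : measurable_fun setT (X n).
Proof. exact: measurable_Lfun (X2 n). Qed.

Let XB2 n k : (fun w => X k w - X n w) \in Lfun P 2%:E.
Proof. exact: Lfun2B. Qed.

(** Stated with the extended integral because [Y] is not yet known to be square integrable;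
    [limit_Lfun2] deduces that from it. *)
Lemma integral_limit_sqr_le n : (\int[P]_w ((Y w - X n w) ^+ 2)%:E <= (r n)%:E)%E.
Proof.
pose f k w := ((X (n + k)%N w - X n w) ^+ 2)%:E.
have mf k : measurable_fun setT (f k).
  by apply/measurable_EFinP; apply: measurable_funX; exact: measurable_funB.
have f0 k w : (0 <= f k w)%E by rewrite lee_fin sqr_ge0.
have fr k : (\int[P]_w f k w <= (r n)%:E)%E.
  have := Xr n k; rewrite -lee_fin /Rintegral fineK//.
  apply: integrable_fin_num => //; apply: integrable_Lfun1.
  exact: (Lfun2_mul_Lfun1 (XB2 n _) (XB2 n _)).
apply: (@le_trans _ _ (\int[P]_w limn_einf (f^~ w))%E); last first.
  apply: le_trans (fatou _ _ mf _) _ => //.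
  rewrite limn_einf_lim; apply: lime_le; first exact: is_cvg_einfs.
  apply: nearW => k; apply: le_trans (fr k); apply: ereal_inf_lbound.
  by exists k => //=.
rewrite le_eqVlt; apply/orP; left; apply/eqP.
apply: ge0_ae_eq_integral => //.
- by apply/measurable_EFinP; apply: measurable_funX; exact: measurable_funB.
- apply: measurableT_comp => //; apply: measurable_fun_limn_esup => k.
  exact: measurableT_comp.
- by move=> w _; rewrite lee_fin sqr_ge0.
- move=> w _; rewrite limn_einf_lim; apply: lime_ge; first exact: is_cvg_einfs.
  by apply: nearW => k; apply: le_ereal_inf_tmp => _ [j _ <-].
apply: filterS XY => w Xw _.
have fY : f^~ w @ \oo --> ((Y w - X n w) ^+ 2)%:E.
  apply: cvg_EFin; first exact: nearW.
  have XnY : X (n + k)%N w - X n w @[k --> \oo] --> Y w - X n w.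
    apply: cvgB; last exact: cvg_cst.
    exact: (cvg_comp _ _ (cvg_addnl n) Xw).
  rewrite expr2 (_ : fine \o _ = fun k => (X (n + k)%N w - X n w) * (X (n + k)%N w - X n w)).
    exact: (cvgM XnY XnY).
  by apply/funext => k /=; rewrite expr2.
by rewrite is_cvg_limn_einfE; [rewrite (cvg_lim _ fY)|apply/cvg_ex; eexists; exact: fY].
Qed.

Lemma limit_Lfun2 : Y \in Lfun P 2%:E.
Proof.
have mYX : measurable_fun setT (fun w => Y w - X 0%N w) by exact: measurable_funB.
have YX : (fun w => Y w - X 0%N w) \in Lfun P 2%:E.
  by apply: Lfun2_of_sqr => //; exact: (le_lt_trans (integral_limit_sqr_le 0) (ltry _)).
rewrite (_ : Y = (fun w => Y w - X 0%N w) \+ X 0%N).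
  exact: Lfun2D.
by apply/funext => w /=; rewrite subrK.
Qed.

Let YX2 n : (fun w => Y w - X n w) \in Lfun P 2%:E.
Proof. by apply: Lfun2B => //; exact: limit_Lfun2. Qed.

Lemma limit_sqr_le n : Ex (fun w => (Y w - X n w) ^+ 2) <= r n.
Proof.
rewrite -lee_fin /Rintegral fineK; first exact: integral_limit_sqr_le.
apply: integrable_fin_num => //; apply: integrable_Lfun1.
exact: (Lfun2_mul_Lfun1 (YX2 n) (YX2 n)).
Qed.

Lemma cvg_Rintegral_mul f : f \in Lfun P 2%:E ->
  Ex (fun w => f w * (Y w - X n w)) @[n --> \oo] --> 0.
Proof.
move=> f2; apply/cvgr0Pnorm_lt => e e0.
set B := Ex (fun w => f w ^+ 2).
have B0 : 0 <= B by apply: Rintegral_ge0 => w _; exact: sqr_ge0.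
have B1 : 0 < B + 1 by rewrite ltr_wpDl.
(* With the parameter [e / (B + 1)] the first term of [Rintegral_mul_le] is at most [e], and the
   second is below [e] once [r n] is below [e] times the parameter. The shift by 1 allows
   [B = 0]. *)
have l0 : 0 < e / (B + 1) by rewrite divr_gt0.
have : \forall n \near \oo, `|r n| < e * (e / (B + 1)).
  by apply: cvgr0_norm_lt => //; rewrite mulr_gt0.
apply: filterS => n rn.
have := Rintegral_mul_le l0 f2 (YX2 n); rewrite -/B.
have lB : e / (B + 1) * B <= e.
  by rewrite mulrAC ler_pdivrMr// ler_wpM2l ?(ltW e0)// lerDl.
have le : (e / (B + 1))^-1 * Ex (fun w => (Y w - X n w) ^+ 2) < e.
  rewrite mulrC ltr_pdivrMr//; apply: le_lt_trans rn.
  exact: le_trans (limit_sqr_le n) (ler_norm _).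
by move=> h; lra.
Qed.

Lemma cvg_Rintegral_limit : Ex (X n) @[n --> \oo] --> Ex Y.
Proof.
have one2 : (fun=> 1) \in Lfun P 2%:E := Lfun_cst P 1 2.
have := cvg_Rintegral_mul one2.
rewrite (_ : (fun n => _) = (fun n => Ex Y - Ex (X n))); last first.
  apply/funext => n; rewrite -RintegralB//; first by under eq_Rintegral do rewrite mul1r.
  - exact/integrable_Lfun1/Lfun21/limit_Lfun2.
  - exact/integrable_Lfun1/Lfun21.
move=> h; rewrite -[X in _ --> X]subr0.
rewrite [X in X @ _ --> _](_ : _ = fun n => Ex Y - (Ex Y - Ex (X n))).
  exact: (cvgB (cvg_cst _) h).
by apply/funext => n; rewrite subKr.
Qed.

Lemma cvg_Rintegral_limit_sqr :
  Ex (fun w => X n w ^+ 2) @[n --> \oo] --> Ex (fun w => Y w ^+ 2).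
Proof.
have Y2 := limit_Lfun2.
have i1 n : P.-integrable setT (EFin \o (fun w => Y w * (Y w - X n w))).
  exact: (integrable_Lfun1 (Lfun2_mul_Lfun1 Y2 (YX2 n))).
have i2 n : P.-integrable setT (EFin \o (fun w => (Y w - X n w) ^+ 2)).
  exact: (integrable_Lfun1 (Lfun2_mul_Lfun1 (YX2 n) (YX2 n))).
have i3 : P.-integrable setT (EFin \o (fun w => Y w ^+ 2)).
  exact: (integrable_Lfun1 (Lfun2_mul_Lfun1 Y2 Y2)).
have sq0 : Ex (fun w => (Y w - X n w) ^+ 2) @[n --> \oo] --> 0.
  apply: (squeeze_cvgr _ (cvg_cst 0) r0); apply: nearW => n.
  rewrite limit_sqr_le andbT; apply: Rintegral_ge0 => w _; exact: sqr_ge0.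
(* Expand [X_n^2 = Y^2 - 2 Y (Y - X_n) + (Y - X_n)^2]; the last two integrals tend to 0. *)
rewrite [X in X @ _ --> _](_ : _ = fun n => Ex (fun w => Y w ^+ 2) -
    2 * Ex (fun w => Y w * (Y w - X n w)) + Ex (fun w => (Y w - X n w) ^+ 2)).
  have h1 : 2 * Ex (fun w => Y w * (Y w - X n w)) @[n --> \oo] --> (2 * 0 : R).
    by apply: cvgM; [exact: cvg_cst|exact: cvg_Rintegral_mul].
  rewrite [X in _ --> X](_ : _ = Ex (fun w => Y w ^+ 2) - 2 * 0 + 0); last first.
    by rewrite mulr0 subr0 addr0.
  apply: cvgD; last exact: sq0.
  by apply: cvgB; [exact: cvg_cst|exact: h1].
apply/funext => n.
have i12 : P.-integrable setT (EFin \o (fun w => 2 * (Y w * (Y w - X n w)))).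
  exact: (integrableZl measurableT 2 (i1 n)).
have iB : P.-integrable setT
    (EFin \o (fun w => Y w ^+ 2 - 2 * (Y w * (Y w - X n w)))).
  exact: (integrableB measurableT i3 i12).
rewrite -(RintegralZl 2 measurableT (i1 n)) -(RintegralB measurableT i3 i12).
rewrite -(RintegralD measurableT iB (i2 n)).
by apply: eq_Rintegral => w _ /=; ring.
Qed.

End square_integrable_limit.

End square_integrable.

(** * Moments of the percolation *)

Section percolation_moments.
Context {R : realType} {d M : nat}.
Variable p : R.
Hypothesis p01 : 0 <= p <= 1.
Context {dO : measure_display} {Omega : measurableType dO}.
Variable P : probability Omega R.
Variable Y : seq 'I_(M ^ d) -> {RV P >-> bool}.
Hypothesis hY : iid_bernoulli p Y.
Local Notation letter := 'I_(M ^ d).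
Local Notation kernel := (seq letter -> seq letter -> R).
Local Notation Ex f := (\int[P]_w f w)%R.

(** Expressed by the distinct labels, the form to which mutual independence applies; [all_keptP]
    recovers the meaning. *)
Definition all_kept (L : seq (seq letter)) : set Omega :=
  \bigcap_(u in [set` prefix_closure L]) (Y u @^-1` [set true]).

Lemma all_keptP L w : reflect (all_kept L w) (all (kept (fun s => Y s w)) L).
Proof.
apply: (iffP allP) => [h u|h s sL].
  rewrite /= mem_prefix_closure => /andP[u0 /hasP[s /h /allP sK us]].
  have := sK (size u); rewrite mem_iota add1n ltnS lt0n size_eq0 u0 size_prefix//.
  by move=> /(_ isT); rewrite (eqP (_ : take (size u) s == u)) -?prefixE.
apply/allP => m; rewrite mem_iota add1n ltnS => /andP[m1 ms].
apply: (h (take m s)) => /=; rewrite mem_prefix_closure; apply/andP; split.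
  by rewrite -size_eq0 size_takel// -lt0n.
by apply/hasP; exists s => //; exact: prefix_take.
Qed.

Lemma measurable_all_kept L : measurable (all_kept L).
Proof.
rewrite /all_kept bigcap_seq; apply: bigsetI_measurable => u _; rewrite -[X in measurable X]setTI.
exact: measurable_funP.
Qed.

Lemma probability_all_kept L : P (all_kept L) = (weight p L)%:E.
Proof.
have [hd hI] := hY; rewrite /all_kept.
rewrite (hI _ (fun=> [set true])) ?undup_uniq//; last first.
  by move=> u; rewrite mem_prefix_closure => /andP[/eqP].
rewrite (eq_big_seq (fun=> p%:E)) => [|u].
  by rewrite /weight; elim: (prefix_closure L) => [|u s IH];
    rewrite ?big_nil// big_cons IH -EFinM -exprS.
rewrite mem_prefix_closure => /andP[/eqP u0 _].
rewrite -[LHS]/(distribution P (Y u) [set true]) hd// bernoulli_probE//.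
by rewrite !diracE mem_set// memNset// mule1 mule0 adde0.
Qed.

Lemma Lfun_all_kept L : (\1_(all_kept L) : Omega -> R) \in Lfun P 2%:E.
Proof.
apply: (@Lfun2_bounded _ _ _ _ _ 1).
  by apply: measurable_indic; exact: measurable_all_kept.
by move=> w; rewrite indicE ger0_norm// lern1 leq_b1.
Qed.

Lemma Rintegral_all_kept L : Ex \1_(all_kept L) = weight p L.
Proof.
have mL := measurable_all_kept L.
by rewrite /Rintegral integral_indic//= setIT probability_all_kept.
Qed.

Lemma Lfun2_sum I (r : seq I) (f : I -> Omega -> R) :
  (forall i, f i \in Lfun P 2%:E) ->
  (fun w => \sum_(i <- r) f i w) \in Lfun P 2%:E.
Proof.
move=> f2; elim: r => [|i r IH].
  under eq_fun do rewrite big_nil; exact: Lfun_cst.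
by under eq_fun do rewrite big_cons; exact: Lfun2D.
Qed.

Lemma Rintegral_sum I (r : seq I) (f : I -> Omega -> R) :
  (forall i, f i \in Lfun P 2%:E) ->
  Ex (fun w => \sum_(i <- r) f i w) = \sum_(i <- r) Ex (f i).
Proof.
move=> f2; elim: r => [|i r IH].
  under eq_Rintegral do rewrite big_nil.
  by rewrite big_nil Rintegral_cst//= mul0r.
under eq_Rintegral do rewrite big_cons.
rewrite big_cons -IH RintegralD//; apply: integrable_Lfun1; apply: Lfun21 => //.
exact: Lfun2_sum.
Qed.

Lemma Lfun2Z (c : R) f : f \in Lfun P 2%:E -> (fun w => c * f w) \in Lfun P 2%:E.
Proof.
move=> f2; rewrite (_ : (fun w => _) = c \o* f); last first.
  by apply/funext => w /=; rewrite mulrC.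
by apply: Lfun_scale; rewrite ?ler1n.
Qed.

Lemma Lfun2_kernel_sum (c : kernel) n (F : seq letter -> seq letter -> Omega -> R) :
  (forall s t, F s t \in Lfun P 2%:E) ->
  (fun w => kernel_sum c n (fun s t => F s t w)) \in Lfun P 2%:E.
Proof. by move=> F2; do 2![apply: Lfun2_sum => ?]; exact: Lfun2Z. Qed.

Lemma Rintegral_kernel_sum (c : kernel) n (F : seq letter -> seq letter -> Omega -> R) :
  (forall s t, F s t \in Lfun P 2%:E) ->
  Ex (fun w => kernel_sum c n (fun s t => F s t w)) =
  kernel_sum c n (fun s t => Ex (F s t)).
Proof.
move=> F2; rewrite Rintegral_sum => [|s]; last first.
  by apply: Lfun2_sum => t; exact: Lfun2Z.
apply: eq_bigr => s _; rewrite Rintegral_sum => [|t]; last exact: Lfun2Z.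
apply: eq_bigr => t _; rewrite RintegralZl//.
exact/integrable_Lfun1/Lfun21.
Qed.

Definition kept_sum (c : kernel) n (w : Omega) : R :=
  kernel_sum c n (fun s t => \1_(all_kept [:: s; t]) w).

Lemma Lfun2_kept_sum c n : kept_sum c n \in Lfun P 2%:E.
Proof. by apply: Lfun2_kernel_sum => s t; exact: Lfun_all_kept. Qed.

Lemma Rintegral_kept_sum c n : Ex (kept_sum c n) = moment p c n [::].
Proof.
rewrite Rintegral_kernel_sum => [|s t]; last exact: Lfun_all_kept.
by apply: eq_kernel_sum => s t _ _ _; exact: Rintegral_all_kept.
Qed.

Lemma indic_all_keptM L L' w :
  \1_(all_kept L) w * \1_(all_kept L') w = \1_(all_kept (L ++ L')) w :> R.
Proof.
have E L0 : \1_(all_kept L0) w = (all (kept (fun s => Y s w)) L0)%:R :> R.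
  rewrite indicE; congr (nat_of_bool _)%:R.
  by apply/idP/all_keptP; rewrite inE.
by rewrite !E all_cat -natrM mulnb.
Qed.

Lemma Rintegral_kept_sumM c n c' k :
  Ex (fun w => kept_sum c n w * kept_sum c' k w) = moment2 p c n c' k.
Proof.
transitivity (Ex (fun w => kernel_sum c n (fun s t =>
    kernel_sum c' k (fun u v => \1_(all_kept [:: u; v; s; t]) w)))).
  apply: eq_Rintegral => w _; rewrite /kept_sum mulrC -kernel_sumZ.
  apply: eq_kernel_sum => s t _ _ _.
  rewrite mulrC -kernel_sumZ; apply: eq_kernel_sum => u v _ _ _.
  by rewrite mulrC indic_all_keptM.
rewrite Rintegral_kernel_sum => [|s t]; last first.
  by apply: Lfun2_kernel_sum => u v; exact: Lfun_all_kept.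
apply: eq_kernel_sum => s t _ _ _.
rewrite Rintegral_kernel_sum => [|u v]; last exact: Lfun_all_kept.
by apply: eq_kernel_sum => u v _ _ _; exact: Rintegral_all_kept.
Qed.

End percolation_moments.

(** * The rescaled surface process as a kernel sum *)

Section surface_process.
Context {R : realType} {d M : nat}.
Hypothesis M_gt1 : (1 < M)%N.
Hypothesis d_gt0 : (0 < d)%N.
Variable p : R.
Hypothesis p_gt : M%:R ^- d < p.
Hypothesis p_le1 : p <= 1.
Context {dO : measure_display} {Omega : measurableType dO}.
Variable P : probability Omega R.
Variable Y : seq 'I_(M ^ d) -> {RV P >-> bool}.
Hypothesis hY : iid_bernoulli p Y.
Local Notation letter := 'I_(M ^ d).
Local Notation kernel := (seq letter -> seq letter -> R).
Local Notation same_cube := (@same_cube R d M).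
Local Notation adjacent_cubes := (@adjacent_cubes R d M).
Local Notation b := (M%:R ^+ d * p)^-1.
Local Notation Ex f := (\int[P]_w f w)%R.

Let M_gt0 : (0 < M)%N. Proof. exact: ltnW. Qed.

Let p_gt0 : 0 < p.
Proof. by apply: lt_trans p_gt; rewrite invr_gt0 exprn_gt0// ltr0n. Qed.

Let p01 : 0 <= p <= 1. Proof. by rewrite ltW. Qed.

Definition combine_kernels (x y : R) (c c' : kernel) : kernel :=
  fun s t => x * c s t + y * c' s t.

Lemma kernel_sum_combine x y c c' n F :
  kernel_sum (combine_kernels x y c c') n F =
  x * kernel_sum c n F + y * kernel_sum c' n F.
Proof.
rewrite /kernel_sum !mulr_sumr -big_split; apply: eq_bigr => s _ /=.
rewrite !mulr_sumr -big_split; apply: eq_bigr => t _ /=.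
by rewrite /combine_kernels mulrDl !mulrA.
Qed.

Lemma moment2_combine x y c c' n c2 k :
  moment2 p (combine_kernels x y c c') n c2 k =
  x * moment2 p c n c2 k + y * moment2 p c' n c2 k.
Proof. exact: kernel_sum_combine. Qed.

(** With this signed kernel [Z_n] is itself a [kept_sum], so its moments follow by bilinearity. *)
Definition surface_kernel n : kernel :=
  combine_kernels (b ^+ n * d%:R) (- b ^+ n) same_cube adjacent_cubes.

Definition surface_sum n (w : Omega) : R := kept_sum Y (surface_kernel n) n w.

Lemma Lfun2_surface_sum n : surface_sum n \in Lfun P 2%:E.
Proof. exact: Lfun2_kept_sum. Qed.

Lemma Rintegral_surface_sum n : Ex (surface_sum n) = surface_mean d M p n.
Proof.
rewrite /surface_sum (Rintegral_kept_sum p01 hY).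
rewrite /moment kernel_sum_combine /surface_mean /normalized_mean /moment; ring.
Qed.

Lemma Rintegral_surface_sumM n k :
  Ex (fun w => surface_sum n w * surface_sum k w) = surface_moment2 d M p n k.
Proof.
rewrite /surface_sum (Rintegral_kept_sumM p01 hY).
rewrite moment2_combine !(moment2C _ _ n) !moment2_combine.
rewrite !(moment2C _ _ k) /surface_moment2 /normalized_moment2; ring.
Qed.

Lemma powR_perc_dim :
  M%:R `^ perc_dim d M p = M%:R ^+ d * p.
Proof.
have M0 : 0 < M%:R :> R by rewrite ltr0n.
have lnM : ln (M%:R : R) != 0.
  by rewrite gt_eqF// ln_gt0// ltr1n.
rewrite /powR gt_eqF// /perc_dim divfK// lnK// posrE.
by rewrite mulr_gt0// exprn_gt0.
Qed.

(** Since [M^perc_dim = M^d p], the factor [M^((d-1-perc_dim) n)] is [b^n (M^n)^(d-1)], and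
    [(M^n)^(d-1)] cancels the size of a facet. *)
Lemma ZsurfE V : intrinsic_volumes V ->
  Zsurf p V (fun s => Y s) = surface_sum.
Proof.
move=> hV; apply/funext => n; apply/funext => w.
have M0 : 0 < M%:R :> R by rewrite ltr0n.
have Mn0 : M%:R != 0 :> R by rewrite gt_eqF.
have -> : surface_sum n w = b ^+ n * ((M%:R ^+ n) ^+ d.-1 *
    V d.-1 (perc_step (fun s => Y s) n w)).
  rewrite (intrinsic_volume_perc_step M_gt0 _ n w hV d_gt0) /surface_sum /kept_sum.
  rewrite kernel_sum_combine kernel_sum_same_cube kernel_sum_adjacent_cubes.
  have indE s t : \1_(all_kept Y [:: s; t]) w =
      (kept (fun s => Y s w) s)%:R * (kept (fun s => Y s w) t)%:R :> R.
    rewrite -natrM mulnb indicE; congr (nat_of_bool _)%:R.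
    have <- : all (kept (fun s => Y s w)) [:: s; t] =
        kept (fun s => Y s w) s && kept (fun s => Y s w) t by rewrite /= andbT.
    by apply/idP/all_keptP; rewrite inE.
  rewrite mulrBr mulrA mulNr; congr (_ * _ - _ * _).
    by apply: eq_bigr => s _; rewrite indE -natrM mulnb andbb.
  by apply: eq_bigr => l _; apply: eq_bigr => s _; apply: eq_bigr => t _; rewrite indE.
rewrite /Zsurf mulrA; congr (_ * _).
rewrite powRrM powR_mulrn ?powR_ge0// powRB ?Mn0 ?implybT// powR_perc_dim.
have -> : d%:R - 1 = d.-1%:R :> R by rewrite -subn1 natrB.
rewrite powR_mulrn ?ler0n//.
by rewrite expr_div_n exprVn mulrC exprAC.
Qed.

Lemma surface_sum_sqr_dist n k :
  Ex (fun w => (surface_sum (n + k) w - surface_sum n w) ^+ 2) =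
  surface_moment2 d M p (n + k) (n + k) - 2 * surface_moment2 d M p n (n + k) +
  surface_moment2 d M p n n.
Proof.
have X2 := Lfun2_surface_sum.
have iX i j : P.-integrable setT
    (EFin \o (fun w => surface_sum i w * surface_sum j w)).
  exact: (integrable_Lfun1 (Lfun2_mul_Lfun1 (X2 i) (X2 j))).
have i1 : P.-integrable setT
    (EFin \o (fun w => 2 * (surface_sum n w * surface_sum (n + k) w))).
  exact: (integrableZl measurableT 2 (iX n (n + k)%N)).
have i2 : P.-integrable setT
    (EFin \o (fun w => surface_sum (n + k) w * surface_sum (n + k) w -
      2 * (surface_sum n w * surface_sum (n + k) w))).
  exact: (integrableB measurableT (iX _ _) i1).
rewrite -!Rintegral_surface_sumM.
rewrite -(RintegralZl 2 measurableT (iX n (n + k)%N)).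
rewrite -(RintegralB measurableT (iX (n + k)%N (n + k)%N) i1).
rewrite -(RintegralD measurableT i2 (iX n n)).
by apply: eq_Rintegral => w _ /=; ring.
Qed.

End surface_process.

(** * Passage to the limit and the variance bounds *)

Lemma cvg_rate0 {R : realType} (a b : R) : [/\ 0 < a, a < 1, 0 < b & b < 1] ->
  rate a b n @[n --> \oo] --> 0.
Proof.
move=> ab; apply: cvg_series_cvg_0; apply: nondecreasing_is_cvgn.
  by apply: nondecreasing_series => n _ _; exact: rate_ge0.
exists ((1 - a) * (1 - b))^-1 => _ [n _ <-].
by rewrite /series /= big_mkord; exact: sum_rate_le.
Qed.

Lemma bigO_nat {R : realType} (f g : nat -> R^o) (K : R) (N : nat) : 0 < K ->
  (forall n, (N <= n)%N -> `|f n| <= K * `|g n|) -> f =O_\oo g.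
Proof.
move=> K0 fg; apply/eqO_exP; exists K => //.
by exists N => // n /= /fg.
Qed.

Theorem corollary3p2 (R : realType) (d M : nat) (p : R)
    (hd : (1 <= d)%N) (hM : (2 <= M)%N) (hp : M%:R ^- d < p <= 1)
    (V : nat -> set 'rV[R]_d -> R) (hV : intrinsic_volumes V)
    (dO : measure_display) (Omega : measurableType dO) (P : probability Omega R)
    (Y : seq 'I_(M ^ d) -> {RV P >-> bool}) (hY : iid_bernoulli p Y)
    (Zoo : {RV P >-> R})
    (hZoo : {ae P, forall w,
       Zsurf p V (fun s => Y s) n w @[n --> \oo] --> Zoo w}) :
  let Z := Zsurf p V (fun s => Y s) in
  [/\ forall n : nat,
        ('E_P[Z n] - 'E_P[Zoo] =
         (d%:R * p * (M%:R - 1) / (M%:R - p) * (p / M%:R) ^+ n)%:E)%E,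
      'V_P[Zoo] \is a fin_num /\ (forall n, 'V_P[Z n] \is a fin_num),
      let dV := (fun n => fine 'V_P[Zoo] - fine 'V_P[Z n]) : nat -> R^o in
      [/\ M%:R ^- d.-1 < p ^+ 2 ->
            dV =O_\oo (fun n => (p / M%:R) ^+ n : R^o),
          p ^+ 2 = M%:R ^- d.-1 ->
            dV =O_\oo (fun n => (p / M%:R) ^+ n * n%:R : R^o) &
          p ^+ 2 < M%:R ^- d.-1 ->
            dV =O_\oo (fun n => (M%:R ^+ d * p) ^- n : R^o)] &
      'V_P[Z n] @[n --> \oo] --> 'V_P[Zoo]].
Proof.
have /andP[p_gt p_le1] := hp; have M_gt1 : (1 < M)%N := hM.
have ab := percolation_rates M_gt1 p_gt p_le1; have [a0 a1 b0 b1] := ab.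
pose a := p / M%:R; pose b := (M%:R ^+ d * p)^-1.
pose kappa := d%:R * p * (M%:R - 1) / (M%:R - p).
have kappa0 : 0 <= kappa.
  have M1 : 1 < M%:R :> R by rewrite ltr1n.
  have p0 : 0 <= p by apply: ltW; apply: lt_trans p_gt; rewrite invr_gt0 exprn_gt0// ltr0n ltnW.
  by rewrite /kappa divr_ge0// ?mulr_ge0// subr_ge0 ltW// (le_lt_trans p_le1).
move=> Z; pose X := surface_sum p Y.
have ZX : Z = X by exact: ZsurfE.
rewrite ZX; have {}hZoo : {ae P, forall w, X n w @[n --> \oo] --> Zoo w}.
  by rewrite -ZX.
pose Ex f := (\int[P]_w f w)%R.
have X2 n : X n \in Lfun P 2%:E by exact: Lfun2_surface_sum.
have [C C0 cauchy] := surface_moment2_cauchy M_gt1 hd p_gt p_le1.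
have r0 : C * rate a b n @[n --> \oo] --> 0.
  by rewrite -(mulr0 C); apply: cvgM; [exact: cvg_cst|exact: cvg_rate0].
have Xr n k : Ex (fun w => (X (n + k)%N w - X n w) ^+ 2) <= C * rate a b n.
  rewrite /Ex (surface_sum_sqr_dist M_gt1 p_gt p_le1 hY).
  exact: (cauchy n k).2.
have mZ : measurable_fun setT Zoo by exact: measurable_funP.
have Z2 : (Zoo : Omega -> R) \in Lfun P 2%:E := limit_Lfun2 X2 mZ hZoo Xr.
have EX n : Ex (X n) = d%:R - kappa + kappa * a ^+ n.
  by rewrite /Ex (Rintegral_surface_sum M_gt1 p_gt p_le1 hY) surface_meanE.
have ar n : 0 <= a ^+ n <= 1 by rewrite exprn_ge0 ?exprn_ile1 ?ltW.
have EZ : Ex Zoo = d%:R - kappa.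
  have h1 : Ex (X n) @[n --> \oo] --> Ex Zoo := cvg_Rintegral_limit X2 mZ hZoo Xr r0.
  have h2 : Ex (X n) @[n --> \oo] --> (d%:R - kappa + kappa * 0 : R).
    under eq_fun do rewrite EX; apply: cvgD; first exact: cvg_cst.
    apply: cvgM; first exact: cvg_cst.
    by apply: cvg_expr; rewrite ger0_norm// ltW.
  by rewrite (cvg_unique _ h1 h2)// mulr0 addr0.
pose SX n := Ex (fun w => X n w ^+ 2); pose SZ := Ex (fun w => Zoo w ^+ 2).
have SXE n : SX n = surface_moment2 d M p n n.
  by rewrite -(Rintegral_surface_sumM M_gt1 p_gt p_le1 hY).
have SXZ : SX n @[n --> \oo] --> SZ := cvg_Rintegral_limit_sqr X2 mZ hZoo Xr r0.
(* Let [k] tend to infinity in the bound on the increments of the diagonal. *)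
have SZr n : `|SZ - SX n| <= C * rate a b n.
  have h : `|SX (n + k)%N - SX n| @[k --> \oo] --> `|SZ - SX n|.
    apply: cvg_norm; apply: cvgB; last exact: cvg_cst.
    exact: (cvg_comp _ _ (cvg_addnl n) SXZ).
  apply: (cvgr_to_le h); apply: nearW => k; rewrite !SXE; exact: (cauchy n k).1.
have VX n : 'V_P[X n]%E = (SX n - Ex (X n) ^+ 2)%:E by exact: variance_Rintegral.
have VZ : 'V_P[Zoo]%E = (SZ - Ex Zoo ^+ 2)%:E by exact: variance_Rintegral.
pose dV n : R := fine 'V_P[Zoo]%E - fine 'V_P[X n]%E.
(* The second part of [K] accounts for the squared means, whose difference is
   [kappa a^n (2 (d - kappa) + kappa a^n)]; it is absorbed because [a^n <= rate n]. *)
pose K := C + kappa * (2 * `|d%:R - kappa| + kappa).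
have K0 : 0 <= K by rewrite addr_ge0// mulr_ge0// addr_ge0// mulr_ge0.
have dVr n : `|dV n| <= K * rate a b n.
  have -> : dV n = (SZ - SX n) + kappa * (a ^+ n * (2 * (d%:R - kappa) + kappa * a ^+ n)).
    by rewrite /dV VX VZ /= EX EZ; ring.
  apply: le_trans (ler_normD _ _) _.
  rewrite /K [X in _ <= X]mulrDl; apply: lerD => //.
  rewrite normrM (ger0_norm kappa0) -[X in _ <= X]mulrA ler_wpM2l// normrM mulrC.
  have /andP[an0 an1] := ar n; have [ra _] := rate_ge ab n.
  apply: ler_pM => //; last by rewrite ger0_norm.
  apply: le_trans (ler_normD _ _) _; apply: lerD.
    by rewrite normrM (ger0_norm (ler0n _ 2)).
  by rewrite (ger0_norm (mulr_ge0 kappa0 an0)); exact: ler_piMr.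
have rate0 n : 0 <= rate a b n := rate_ge0 ab n.
have bE n : (M%:R ^+ d * p) ^- n = b ^+ n :> R by rewrite exprVn.
(* The sign of [a - b] is that of [p^2 - M^(1-d)], which links the three cases to the behaviour of
   [rate]. *)
have abE : a - b = (p ^+ 2 - M%:R ^- d.-1) / (p * M%:R).
  have M0 : M%:R != 0 :> R by rewrite gt_eqF// ltr0n ltnW.
  have p0 : p != 0 by apply: contraTneq a0 => ->; rewrite mul0r ltxx.
  rewrite /a /b -[in M%:R ^+ d](prednK hd) exprS; field.
  by rewrite M0 p0 expf_neq0.
have pM0 : 0 < (p * M%:R)^-1.
  have M0 : 0 < M%:R :> R by rewrite ltr0n ltnW.
  by rewrite invr_gt0 mulr_gt0//; move: a0; rewrite pmulr_lgt0 ?invr_gt0.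
(* The added 1 keeps the constant positive, as [bigO_nat] requires, even when [K * k = 0]. *)
have dV_le (k t : R) n : 0 <= t -> rate a b n <= k * t -> `|dV n| <= (K * k + 1) * t.
  move=> t0 /(ler_wpM2l K0) h; apply: le_trans (dVr n) _; apply: le_trans h _.
  by rewrite [X in _ <= X]mulrDl mulrA mul1r lerDl.
split.
- move=> n; rewrite !expectation_Rintegral ?Lfun21//.
  by rewrite -EFinB -/(Ex (X n)) -/(Ex Zoo) EX EZ addrAC subrr add0r.
- by split=> [|n]; rewrite ?VZ ?VX.
- split.
  + move=> lt; have ba : 0 < a - b by rewrite abE mulr_gt0// subr_gt0.
    apply: (@bigO_nat _ _ _ (K * (a - b)^-1 + 1) 0).
      by rewrite ltr_wpDl// mulr_ge0// invr_ge0 ltW.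
    move=> n _; have /andP[an0 _] := ar n; rewrite (ger0_norm an0).
    apply: dV_le => //; rewrite mulrC ler_pdivlMr// mulrC rate_diff.
    apply: (@le_trans _ _ (a ^+ n.+1)).
      by rewrite lerBlDr lerDl exprn_ge0// ltW.
    by rewrite exprS ler_piMl// ltW.
  + move=> e; have abe : a = b by apply/eqP; rewrite -subr_eq0 abE e subrr mul0r.
    (* The comparison starts at [n = 1], where [n + 1 <= 2 n] begins to hold; at [n = 0] the
       bounding function vanishes. *)
    apply: (@bigO_nat _ _ _ (K * 2 + 1) 1).
      by rewrite ltr_wpDl// mulr_ge0.
    move=> n n1; have /andP[an0 _] := ar n.
    have ann : 0 <= a ^+ n * n%:R by rewrite mulr_ge0.
    rewrite (ger0_norm ann); apply: dV_le => //.
    rewrite (rate_eq _ abe) mulrCA mulrC ler_wpM2l// -natrM ler_nat.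
    by rewrite mul2n -addnn -addn1 leq_add2l.
  + move=> lt; have ba : 0 < b - a.
      by rewrite -opprB abE oppr_gt0 pmulr_llt0// subr_lt0.
    apply: (@bigO_nat _ _ _ (K * (b - a)^-1 + 1) 0).
      by rewrite ltr_wpDl// mulr_ge0// invr_ge0 ltW.
    move=> n _; rewrite bE; have bn0 := exprn_ge0 n (ltW b0).
    rewrite (ger0_norm bn0); apply: dV_le => //.
    rewrite mulrC ler_pdivlMr// mulrC -opprB mulNr rate_diff opprB.
    apply: (@le_trans _ _ (b ^+ n.+1)).
      by rewrite lerBlDr lerDl exprn_ge0// ltW.
    by rewrite exprS ler_piMl// ltW.
- rewrite VZ; under eq_fun do rewrite VX.
  apply: cvg_EFin; first exact: nearW.
  apply: cvgB => //=; rewrite expr2; under eq_fun do rewrite expr2.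
  have h1 : Ex (X n) @[n --> \oo] --> Ex Zoo := cvg_Rintegral_limit X2 mZ hZoo Xr r0.
  exact: cvgM.
Qed.
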